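(* Let $f,g,F,\sigma,L_{\nabla g},L_{\nabla F}$ be as in the context. Let $\mu>0$, $\underline{\alpha}>0$ and $\beta\ge 0$ satisfy $$\mu(\sigma-L_{\nabla g}\underline{\alpha})>\beta(\mu^2+1),$$ and let $\overline{\alpha}>\underline{\alpha}$ be such that $M_1>M_2$, where $$M_1=\frac{\sigma-\overline{\alpha}L_{\nabla g}}{2\overline{\alpha}}-\frac{\mu\beta}{2\underline{\alpha}},\qquad M_2=\frac{\beta}{2\mu\underline{\alpha}}.$$ Assume that $f+g$ is coercive, i.e. $\lim_{\|x\|\to+\infty}(f+g)(x)=+\infty$, and semi-algebraic. Let $(x_n)_{n\in\mathbb{N}}$ be a sequence generated by Algorithm 1 (defined in the context) with the parameters $\underline{\alpha},\overline{\alpha},\beta$. Then: (a) $\sum_{n\in\mathbb{N}}\|x_{n+1}-x_n\|<+\infty$; (b) there exists $x\in\operatorname{crit}(f+g)$ such that $\lim_{n\to+\infty}x_n=x$.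
   Context: $\mathbb{N}=\{0,1,2,\dots\}$, $m\ge 1$, and $\mathbb{R}^m$ carries the Euclidean scalar product $\langle\cdot,\cdot\rangle$ and norm $\|\cdot\|$. Setting. $f:\mathbb{R}^m\to(-\infty,+\infty]$ is proper (not identically $+\infty$), lower semicontinuous and bounded below. $g:\mathbb{R}^m\to\mathbb{R}$ is Fréchet differentiable with $L_{\nabla g}$-Lipschitz continuous gradient, $L_{\nabla g}\ge 0$. $F:\mathbb{R}^m\to\mathbb{R}$ is $\sigma$-strongly convex (i.e. $F-\frac{\sigma}{2}\|\cdot\|^2$ is convex), Fréchet differentiable, with $L_{\nabla F}$-Lipschitz continuous gradient, where $\sigma,L_{\nabla F}>0$. No convexity of $f$ or $g$ is assumed. The Bregman distance is $D_F(x,y)=F(x)-F(y)-\langle\nabla F(y),x-y\rangle$. Algorithm 1. Choose $x_0,x_1\in\mathbb{R}^m$, $\underline{\alpha},\overline{\alpha}>0$, $\beta\ge 0$ and sequences $(\alpha_n)_{n\ge1},(\beta_n)_{n\ge1}$ with $0<\underline{\alpha}\le\alpha_n\le\overline{\alpha}$ and $0\le\beta_n\le\beta$ for all $n\ge1$. A sequence $(x_n)_{n\in\mathbb{N}}$ is generated by Algorithm 1 if for all $n\ge 1$ $$x_{n+1}\in\operatorname{argmin}_{u\in\mathbb{R}^m}\{D_F(u,x_n)+\alpha_n\langle u,\nabla g(x_n)\rangle+\beta_n\langle u,x_{n-1}-x_n\rangle+\alpha_nf(u)\}.$$ (The argmin is a nonempty set, not necessarily a singleton; any selection is allowed.) Subdifferentials.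 For a proper lower semicontinuous $h:\mathbb{R}^m\to(-\infty,+\infty]$ with $\operatorname{dom}h=\{x:h(x)<+\infty\}$ and $x\in\operatorname{dom}h$, the Fréchet subdifferential is $$\hat\partial h(x)=\Big\{v\in\mathbb{R}^m:\liminf_{y\to x}\frac{h(y)-h(x)-\langle v,y-x\rangle}{\|y-x\|}\ge0\Big\},$$ and the limiting subdifferential is $$\partial h(x)=\{v:\exists x_n\to x,\ h(x_n)\to h(x),\ \exists v_n\in\hat\partial h(x_n),\ v_n\to v\};$$ both are empty for $x\notin\operatorname{dom}h$. Put $\operatorname{crit}(h)=\{x:0\in\partial h(x)\}$. Semi-algebraic. A subset of $\mathbb{R}^d$ is semi-algebraic if it is a finite union of sets each defined by finitely many real polynomial equations and strict inequalities; $h:\mathbb{R}^m\to(-\infty,+\infty]$ is semi-algebraic if its graph $\{(x,t)\in\mathbb{R}^{m+1}:h(x)=t\}$ is a semi-algebraic set. *)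

(* Defs.v *)
From HB Require Import structures.
From mathcomp Require Import all_boot all_order all_algebra.
From mathcomp Require Import all_classical all_reals all_analysis.
From mathcomp Require mpoly.

Set Implicit Arguments.
Unset Strict Implicit.
Unset Printing Implicit Defensive.

Import Order.TTheory GRing.Theory Num.Theory.
Import numFieldTopology.Exports numFieldNormedType.Exports.

Local Open Scope classical_set_scope.
Local Open Scope ring_scope.

Section EuclideanSpace.
Context {R : realType} {m : nat}.
Implicit Types (u v x y : 'rV[R]_m) (g F : 'rV[R]_m -> R).

Definition dotp u v : R := \sum_i u 0 i * v 0 i.

(* The norm that MathComp-Analysis puts on 'rV[R]_m is the sup norm. It induces
   the same topology as the Euclidean norm, so convergence and Frechet
   differentiability are the library's, but all quantitative statements must go
   through enorm. *)
Definition enorm u : R := Num.sqrt (dotp u u).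

(* Junk value where g is not differentiable. *)
Definition grad g x : 'rV[R]_m := \row_i 'd g x (delta_mx 0 i).

Definition lipschitz_gradient (L : R) g : Prop :=
  forall x y, enorm (grad g x - grad g y) <= L * enorm (x - y).

Definition strongly_convex (sigma : R) F : Prop :=
  convex_function [set: 'rV[R]_m]
    (fun x => F x - sigma / 2 * enorm x ^+ 2 : R^o).

Definition bregman F x y : R := F x - F y - dotp (grad F y) (x - y).

End EuclideanSpace.

Section ExtendedRealFunctions.
Context {R : realType} {m : nat}.
Implicit Types (h : 'rV[R]_m -> \bar R) (x v : 'rV[R]_m).
Local Open Scope ereal_scope.

Definition proper_fun h : Prop :=
  (forall x, h x != -oo) /\ (exists x, h x < +oo).

Definition bounded_below h : Prop := exists c : R, forall x, c%:E <= h x.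

Definition coercive h : Prop :=
  forall A : R, exists r : R, forall x, (r < enorm x)%R -> A%:E < h x.

Definition argmin h : set 'rV[R]_m := [set x | forall y, h x <= h y].

Definition frechet_subdiff h x : set 'rV[R]_m :=
  [set v | h x < +oo /\
     0 <= limf_einf
            (fun y => (h y - h x - (dotp v (y - x))%:E) / (enorm (y - x))%:E)
            x^'].

Definition limiting_subdiff h x : set 'rV[R]_m :=
  [set v | h x < +oo /\
     exists xs vs : nat -> 'rV[R]_m,
       [/\ xs n @[n --> \oo] --> x,
           h (xs n) @[n --> \oo] --> h x,
           forall n, frechet_subdiff h (xs n) (vs n)
         & vs n @[n --> \oo] --> v]].

Definition crit h : set 'rV[R]_m := [set x | limiting_subdiff h x 0%R].

End ExtendedRealFunctions.

Section SemiAlgebraic.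
Context {R : realType}.

Definition basic_semialg_set d (eqs ineqs : seq (mpoly.mpoly d R)) :
    set 'rV[R]_d :=
  [set v | all (fun p => mpoly.meval (v 0) p == 0) eqs /\
           all (fun q => 0 < mpoly.meval (v 0) q) ineqs].

Definition semialg_set d (A : set 'rV[R]_d) : Prop :=
  exists (k : nat) (eqs ineqs : 'I_k -> seq (mpoly.mpoly d R)),
    A = \bigcup_(i in [set: 'I_k]) basic_semialg_set (eqs i) (ineqs i).

(* A point (x, t) of R^m x R is the row vector of size m + 1 with left block x
   and last entry t. *)
Definition graph m (h : 'rV[R]_m -> \bar R) : set 'rV[R]_(m + 1) :=
  [set z | h (lsubmx z) = (rsubmx z 0 0)%:E].

Definition semialg_fun m (h : 'rV[R]_m -> \bar R) : Prop :=
  semialg_set (graph h).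

End SemiAlgebraic.

Section Algorithm.
Context {R : realType} {m : nat}.

Definition inertial_objective (f : 'rV[R]_m -> \bar R) (g F : 'rV[R]_m -> R)
    (a b : R) (xprev xcur u : 'rV[R]_m) : \bar R :=
  ((bregman F u xcur + a * dotp u (grad g xcur)
    + b * dotp u (xprev - xcur))%:E + a%:E * f u)%E.

Definition generated_by_algorithm (f : 'rV[R]_m -> \bar R)
    (g F : 'rV[R]_m -> R) (alpha beta : nat -> R) (x : nat -> 'rV[R]_m) : Prop :=
  forall n, (1 <= n)%N ->
    argmin (inertial_objective f g F (alpha n) (beta n) (x n.-1) (x n)) (x n.+1).

End Algorithm.

(* Main.v *)
Require Import Defs.
From mathcomp Require Import all_boot all_order all_algebra.
From mathcomp Require Import all_classical all_reals all_analysis.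
From mathcomp Require Import ring lra.
From mathcomp Require mpoly.
From mathcomp.real_closed Require polyrcf ordered_qelim qe_rcf.
Import Order.TTheory GRing.Theory Num.Theory.
Import numFieldTopology.Exports numFieldNormedType.Exports.
Local Open Scope classical_set_scope.
Local Open Scope ring_scope.
Set Implicit Arguments.
Unset Strict Implicit.
Unset Printing Implicit Defensive.

(* Write h = f + g.  A minimizer x_(n+1) of the n-th subproblem satisfies a
   global proximal inequality
     h u >= h x_(n+1) + <v, u - x_(n+1)> - K |u - x_(n+1)|^2   for all u,
   with |v| bounded by the last two steps, and
   H_n = h x_n + M2 |x_n - x_(n-1)|^2 decreases by (M1 - M2) |x_(n+1) - x_n|^2.

   Let A_t be the set of triples (x, y, v) in a large ball such that
   h x + M2 |x - y|^2 = t and v satisfies the proximal inequality at x.  Each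
   A_t is compact and the family is definable over the ordered field R, so that
   quantifier elimination provides a selection z t of A_t minimizing
   r = |v|^2 + |x - y|^2 all of whose coordinates are monotone to the right of
   a = lim H_n, as is r (z t).  Comparing two levels s < t through the
   proximal inequality gives t - s <= C |r|^(1/2) |z t - z s| + K |z t - z s|^2.
   Hence the total variation Phi of z, which is bounded, desingularizes:
   t - s <= C' rho (Phi t - Phi s) whenever A_t has a point with r <= rho^2.
   Applied to t = H_n and s = H_(n+1) this is the Kurdyka-Lojasiewicz
   inequality which makes the length of the trajectory finite. *)

(** * Definable sets *)

(** Quantifier elimination is exploited in one variable only: a definable condition on the level [t]
    holds for every or for no [t] just to the right of [a]. This is why the problem is cut into
    level sets, and why no more than monotonicity is known of the selection: [z] may be
    discontinuous and is never differentiated. Total variation therefore replaces the length of a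
    curve, and the desingularizing inequality is written with increments instead of a derivative;
    its quadratic term disappears under subdivision, and a jump of [z] only makes [Phi] grow more.
    The proximal inequality, unlike a subgradient defined by a limit, speaks of points only, has a
    fixed constant [K], is a closed condition, and can be tested at a point of any other level. The
    component [y] is there because the decreasing quantity is a function of two successive iterates.
    Minimizing [r] serves the comparison with the algorithm: an iterate is an arbitrary point of its
    level set, and the selected point must not be steeper. *)

Module ord := ordered_qelim.ord.

Section Definability.
Context {R : realType}.

(* A context of real variables is a type [I]; quantifying over all the
   assignments [c] of variable numbers makes definability stable under
   renaming of variables. *)
Definition definable (I : Type) (A : (I -> R) -> Prop) :=
  forall c : I -> nat, exists f : ord.formula R,
    forall e : seq R, A (fun i => e`_(c i)) <-> ord.holds e f.

(** [GRing.rterm] excludes inverses, so the term denotes a polynomial; continuity can then be proved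
    by induction on the term. *)
Definition polyfun (I : Type) (p : (I -> R) -> R) :=
  forall c : I -> nat, exists2 t : GRing.term R, GRing.rterm t &
    forall e : seq R, p (fun i => e`_(c i)) = GRing.eval e t.

Lemma polyfun_var (I : Type) (i : I) : polyfun (fun z => z i).
Proof. by move=> c; exists (GRing.Var _ (c i)). Qed.

Lemma polyfun_cst (I : Type) (a : R) : polyfun (fun _ : I -> R => a).
Proof. by move=> c; exists (GRing.Const a). Qed.

Lemma polyfunD (I : Type) (p q : (I -> R) -> R) :
  polyfun p -> polyfun q -> polyfun (fun z => p z + q z).
Proof.
move=> hp hq c; have [t rt ht] := hp c; have [u ru hu] := hq c.
by exists (GRing.Add t u) => [|e] /=; rewrite ?rt// ht hu.
Qed.

Lemma polyfunM (I : Type) (p q : (I -> R) -> R) :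
  polyfun p -> polyfun q -> polyfun (fun z => p z * q z).
Proof.
move=> hp hq c; have [t rt ht] := hp c; have [u ru hu] := hq c.
by exists (GRing.Mul t u) => [|e] /=; rewrite ?rt// ht hu.
Qed.

Lemma polyfunN (I : Type) (p : (I -> R) -> R) :
  polyfun p -> polyfun (fun z => - p z).
Proof.
by move=> hp c; have [t rt ht] := hp c; exists (GRing.Opp t) => //= e;
  rewrite ht.
Qed.

Lemma polyfunB (I : Type) (p q : (I -> R) -> R) :
  polyfun p -> polyfun q -> polyfun (fun z => p z - q z).
Proof. by move=> hp hq; apply: polyfunD => //; exact: polyfunN. Qed.

Lemma polyfunX (I : Type) (p : (I -> R) -> R) n :
  polyfun p -> polyfun (fun z => p z ^+ n).
Proof.
by move=> hp c; have [t rt ht] := hp c; exists (GRing.Exp t n) => //= e;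
  rewrite ht.
Qed.

Lemma polyfun_sum (I J : Type) (r : seq J) (p : J -> (I -> R) -> R) :
  (forall j, polyfun (p j)) -> polyfun (fun z => \sum_(j <- r) p j z).
Proof.
move=> hp c; elim: r => [|j r [t rt ht]].
  by exists (GRing.Const 0) => // e; rewrite big_nil.
have [u ru hu] := hp j c; exists (GRing.Add u t) => [|e] /=.
  by rewrite ru.
by rewrite big_cons hu ht.
Qed.

Lemma polyfun_prod (I J : Type) (r : seq J) (p : J -> (I -> R) -> R) :
  (forall j, polyfun (p j)) -> polyfun (fun z => \prod_(j <- r) p j z).
Proof.
move=> hp c; elim: r => [|j r [t rt ht]].
  by exists (GRing.Const 1) => // e; rewrite big_nil.
have [u ru hu] := hp j c; exists (GRing.Mul u t) => [|e] /=.
  by rewrite ru.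
by rewrite big_cons hu ht.
Qed.

Lemma polyfun_reindex (I K : Type) (s : I -> K) (p : (I -> R) -> R) :
  polyfun p -> polyfun (fun w : K -> R => p (fun i => w (s i))).
Proof. by move=> hp c; exact: (hp (c \o s)). Qed.

Lemma polyfun_meval (I : Type) n (s : 'I_n -> I) (p : mpoly.mpoly n R) :
  polyfun (fun z => mpoly.meval (fun i => z (s i)) p).
Proof.
have -> : (fun z => mpoly.meval (fun i => z (s i)) p) =
    (fun z : I -> R => \sum_(m <- mpoly.msupp p)
       mpoly.mcoeff m p * \prod_(i <- index_enum 'I_n) 
         z (s i) ^+ mpoly.fun_of_multinom m i).
  by apply/funext => z; rewrite mpoly.mevalE.
apply: polyfun_sum => m; apply: polyfunM; first exact: polyfun_cst.
by apply: polyfun_prod => i; apply/polyfunX/polyfun_var.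
Qed.

Lemma polyfun_continuous n (p : ('I_n -> R) -> R) :
  polyfun p -> continuous (fun z : 'rV[R]_n => p (z 0)).
Proof.
move=> /(_ (@nat_of_ord n))[t rt ht].
pose e (z : 'rV[R]_n) := [seq z 0 i | i <- enum 'I_n].
have eE z (i : 'I_n) : (e z)`_i = z 0 i.
  by rewrite (nth_map i) ?size_enum_ord// nth_ord_enum.
have -> : (fun z : 'rV[R]_n => p (z 0)) = (fun z => GRing.eval (e z) t).
  by apply/funext => z; rewrite -ht; congr p; apply/funext => i; rewrite eE.
elim: t rt {ht} => //=.
- move=> k _; have [kn|nk] := ltnP k n.
    rewrite (_ : (fun z => _) = (fun z : 'rV[R]_n => z 0 (Ordinal kn))).
      exact: coord_continuous.
    by apply/funext => z; rewrite -eE.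
  (* A variable number beyond [n] reads the default [0] of [nth], hence does not depend on [z]. *)
  rewrite (_ : (fun z => _) = (fun=> 0)); first exact: cst_continuous.
  by apply/funext => z; rewrite nth_default// size_map size_enum_ord.
- by move=> a _; exact: cst_continuous.
- by move=> k _; exact: cst_continuous.
- move=> t iht u ihu /andP[/iht ct /ihu cu] z.
  by apply: continuousD; [exact: ct|exact: cu].
- by move=> t iht /iht ct z; apply: continuousN; exact: ct.
- move=> t iht k /iht ct.
  rewrite (_ : (fun z => _) = (fun z => GRing.eval (e z) t * k%:R)); last first.
    by apply/funext => z; rewrite mulr_natr.
  move=> z; apply: (@continuousM R 'rV[R]_n (fun z => GRing.eval (e z) t)
    (fun=> k%:R)); [exact: ct|exact: cst_continuous].
- move=> t iht u ihu /andP[/iht ct /ihu cu] z.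
  apply: (@continuousM R 'rV[R]_n (fun z => GRing.eval (e z) t)
    (fun z => GRing.eval (e z) u)); [exact: ct|exact: cu].
- move=> t iht k /iht ct z.
  apply: (@continuous_comp 'rV[R]_n R R (fun z => GRing.eval (e z) t)
    (fun a => a ^+ k)); [exact: ct|exact: exprn_continuous].
Qed.

Lemma definable_ext (I : Type) (A B : (I -> R) -> Prop) :
  (forall z, A z <-> B z) -> definable A -> definable B.
Proof.
move=> AB hA c; have [f hf] := hA c; exists f => e.
by rewrite -hf; split=> /AB.
Qed.

Lemma definable_reindex (I K : Type) (s : I -> K) (A : (I -> R) -> Prop) :
  definable A -> definable (fun w : K -> R => A (fun i => w (s i))).
Proof. by move=> hA c; have [f hf] := hA (c \o s); exists f. Qed.

Lemma definable_le (I : Type) (p q : (I -> R) -> R) :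
  polyfun p -> polyfun q -> definable (fun z => p z <= q z).
Proof.
move=> hp hq c; have [t _ ht] := hp c; have [u _ hu] := hq c.
by exists (ord.Le t u) => e /=; rewrite ht hu.
Qed.

Lemma definable_lt (I : Type) (p q : (I -> R) -> R) :
  polyfun p -> polyfun q -> definable (fun z => p z < q z).
Proof.
move=> hp hq c; have [t _ ht] := hp c; have [u _ hu] := hq c.
by exists (ord.Lt t u) => e /=; rewrite ht hu.
Qed.

Lemma definable_eq (I : Type) (p q : (I -> R) -> R) :
  polyfun p -> polyfun q -> definable (fun z => p z = q z).
Proof.
move=> hp hq c; have [t _ ht] := hp c; have [u _ hu] := hq c.
by exists (ord.Equal t u) => e /=; rewrite ht hu.
Qed.

Lemma definable_and (I : Type) (A B : (I -> R) -> Prop) :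
  definable A -> definable B -> definable (fun z => A z /\ B z).
Proof.
move=> hA hB c; have [f hf] := hA c; have [g hg] := hB c.
by exists (ord.And f g) => e /=; rewrite hf hg.
Qed.

Lemma definable_or (I : Type) (A B : (I -> R) -> Prop) :
  definable A -> definable B -> definable (fun z => A z \/ B z).
Proof.
move=> hA hB c; have [f hf] := hA c; have [g hg] := hB c.
by exists (ord.Or f g) => e /=; rewrite hf hg.
Qed.

Lemma definable_not (I : Type) (A : (I -> R) -> Prop) :
  definable A -> definable (fun z => ~ A z).
Proof.
by move=> hA c; have [f hf] := hA c; exists (ord.Not f) => e /=; rewrite hf.
Qed.

Lemma definable_imp (I : Type) (A B : (I -> R) -> Prop) :
  definable A -> definable B -> definable (fun z => A z -> B z).
Proof.
move=> hA hB c; have [f hf] := hA c; have [g hg] := hB c.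
by exists (ord.Implies f g) => e /=; rewrite hf hg.
Qed.

Lemma definable_all_seq (I : Type) (J : eqType) (r : seq J)
    (A : J -> (I -> R) -> Prop) :
  (forall j, definable (A j)) ->
  definable (fun z => forall j, j \in r -> A j z).
Proof.
move=> hA; elim: r => [|j r ih].
  by move=> c; exists (ord.Bool true) => e; split.
apply: definable_ext (definable_and (hA j) ih) => z; split=> [[Aj Ar] i|Az].
  by rewrite inE => /predU1P[->//|]; exact: Ar.
by split=> [|i ir]; apply: Az; rewrite inE ?eqxx ?ir ?orbT.
Qed.

Lemma definable_all (I J : Type) (r : seq J) (A : J -> (I -> R) -> bool) :
  (forall j, definable (A j)) -> definable (fun z => all (A^~ z) r).
Proof.
move=> hA; elim: r => [|j r ih].
  by move=> c; exists (ord.Bool true) => e; split.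
apply: definable_ext (definable_and (hA j) ih) => z /=.
by split=> /andP.
Qed.

Lemma definable_exists_fin (I : Type) (J : finType)
    (A : J -> (I -> R) -> Prop) :
  (forall j, definable (A j)) -> definable (fun z => exists j, A j z).
Proof.
move=> hA.
have := definable_not (definable_all_seq (enum J)
  (fun j => definable_not (hA j))).
apply: definable_ext => z; split=> [nA|[j Aj] /(_ j)]; last first.
  by rewrite mem_enum => /(_ isT); exact.
apply: contrapT => nex; apply: nA => j _ Aj; apply: nex; exists j; exact: Aj.
Qed.

Lemma holds_exists_seq (f : ord.formula R) (s : seq nat) (e : seq R) :
  ord.holds e (foldr (fun i g => ord.Exists i g) f s) <->
  exists e' : seq R,
    (forall k, k \notin s -> e'`_k = e`_k) /\ ord.holds e' f.
Proof.
elim: s e => [|i s ih] e /=.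
  split=> [he|[e' [e'e]]]; first by exists e.
  by apply: ord.eq_holds => k; rewrite e'e.
split=> [[a /ih[e' [e'e e'f]]]|[e' [e'e e'f]]].
  exists e'; split=> // k; rewrite inE negb_or => /andP[ki ks].
  by rewrite e'e// nth_set_nth /= (negbTE ki).
exists e'`_i; apply/ih; exists e'; split=> // k ks.
rewrite nth_set_nth /=; have [->//|ki] := eqVneq k i.
by rewrite e'e// inE negb_or ki.
Qed.

Lemma definable_exists (I J : finType) (A : (I -> R) -> (J -> R) -> Prop) :
  definable (fun w : I + J -> R => A (w \o inl) (w \o inr)) ->
  definable (fun z => exists y, A z y).
Proof.
move=> hA c; pose n := (\max_i c i).+1.
have cn i : (c i < n)%N by rewrite ltnS leq_bigmax.
pose v (j : J) := (n + enum_rank j)%N.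
have [f hf] := hA (fun k => match k with inl i => c i | inr j => v j end).
exists (foldr (fun i g => ord.Exists i g) f [seq v j | j <- enum J]) => e.
rewrite holds_exists_seq.
have cv i : c i \notin [seq v j | j <- enum J].
  apply/mapP => -[j _ cij]; have := cn i.
  by rewrite cij /v ltnNge leq_addr.
split=> [[y Ay]|[e' [e'e /hf Ae']]]; last first.
  exists (fun j => e'`_(v j)); move: Ae'; congr (A _ _).
  by apply/funext => i /=; rewrite e'e.
pose e' := mkseq (fun k => if [pick j | v j == k] is Some j then y j else e`_k)
  (maxn (size e) (n + #|J|)).
have e'E k : e'`_k = if [pick j | v j == k] is Some j then y j else e`_k.
  have [kl|kl] := ltnP k (maxn (size e) (n + #|J|)).
    by rewrite nth_mkseq.
  rewrite nth_default ?size_mkseq//; case: pickP => [j /eqP vj|_].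
    move: kl; rewrite -vj geq_max /v leq_add2l => /andP[_].
    by rewrite leqNgt ltn_ord.
  by rewrite nth_default// (leq_trans _ kl)// leq_maxl.
exists e'; split=> [k kv|].
  rewrite e'E; case: pickP => [j /eqP vj|//].
  by rewrite -vj map_f ?mem_enum in kv.
apply/hf; move: Ay; congr (A _ _); apply/funext => i /=; rewrite e'E.
  case: pickP => [j /eqP vj|//].
  by have := cv i; rewrite -vj map_f ?mem_enum.
case: pickP => [j /eqP/addnI/val_inj/enum_rank_inj -> //|/(_ i)].
by rewrite eqxx.
Qed.

Lemma definable_forall (I J : finType) (A : (I -> R) -> (J -> R) -> Prop) :
  definable (fun w : I + J -> R => A (w \o inl) (w \o inr)) ->
  definable (fun z => forall y, A z y).
Proof.
move=> hA; have := definable_not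
  (@definable_exists I J (fun z y => ~ A z y) (definable_not hA)).
apply: definable_ext => z; split=> [nA y|Az [y]]; last exact.
by apply: contrapT => nAy; apply: nA; exists y.
Qed.

Lemma definable_existsR (I : finType) (A : (I -> R) -> R -> Prop) :
  definable (fun w : I + unit -> R => A (w \o inl) (w (inr tt))) ->
  definable (fun z => exists a, A z a).
Proof.
move=> hA; have := @definable_exists I unit (fun z y => A z (y tt)) hA.
apply: definable_ext => z; split=> [[y]|[a]]; first by exists (y tt).
by exists (fun=> a).
Qed.

Lemma definable_forallR (I : finType) (A : (I -> R) -> R -> Prop) :
  definable (fun w : I + unit -> R => A (w \o inl) (w (inr tt))) ->
  definable (fun z => forall a, A z a).
Proof.
move=> hA; have := @definable_forall I unit (fun z y => A z (y tt)) hA.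
apply: definable_ext => z; split=> Az a; last exact: (Az (a tt)).
exact: (Az (fun=> a)).
Qed.

(** A nonzero polynomial has finitely many roots; [neighpr] is the open interval from [a] to the
    next root, cut off at [a + 1]. *)
Lemma poly_sign_right (p : {poly R}) (a : R) :
  exists2 b, a < b & forall s t, a < s < b -> a < t < b ->
    Num.sg p.[s] = Num.sg p.[t].
Proof.
have [->|p0] := eqVneq p 0.
  by exists (a + 1); rewrite ?ltrDl// => s t _ _; rewrite !horner0.
have [|y yp] := @polyrcf.neighpr_wit _ p a (a + 1) _ p0; first by rewrite ltrDl.
have ay : a < y by move: yp; rewrite /polyrcf.neighpr in_itv/= => /andP[].
exists y => // s t /andP[as_ sy] /andP[at_ ty].
have sub u : a < u -> u < y -> u \in polyrcf.neighpr p a (a + 1).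
  move: yp; rewrite /polyrcf.neighpr !in_itv/= => /andP[_ yn] au uy.
  by rewrite au/= (lt_trans uy).
by rewrite !(@polyrcf.sgr_neighpr _ (a + 1) p a)// sub.
Qed.

Lemma eval_rterm_poly (e : seq R) (i : nat) (t : GRing.term R) :
  GRing.rterm t ->
  exists p : {poly R}, forall x, GRing.eval (set_nth 0 e i x) t = p.[x].
Proof.
move=> rt; exists (qe_rcf.eval_poly e (qe_rcf.abstrX i (qe_rcf.to_rterm t))).
by move=> x; rewrite qe_rcf.abstrXP qe_rcf.evalE qe_rcf.to_rtermE.
Qed.

Lemma qf_eval_right (e : seq R) (i : nat) (a : R) (f : ord.formula R) :
  ord.qf_form f -> ord.rformula f ->
  exists2 b, a < b & forall s t, a < s < b -> a < t < b ->
    ord.qf_eval (set_nth 0 e i s) f = ord.qf_eval (set_nth 0 e i t) f.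
Proof.
have two f1 f2 (op : bool -> bool -> bool) :
    (exists2 b, a < b & forall s t, a < s < b -> a < t < b ->
      ord.qf_eval (set_nth 0 e i s) f1 = ord.qf_eval (set_nth 0 e i t) f1) ->
    (exists2 b, a < b & forall s t, a < s < b -> a < t < b ->
      ord.qf_eval (set_nth 0 e i s) f2 = ord.qf_eval (set_nth 0 e i t) f2) ->
    exists2 b, a < b & forall s t, a < s < b -> a < t < b ->
      op (ord.qf_eval (set_nth 0 e i s) f1) (ord.qf_eval (set_nth 0 e i s) f2) =
      op (ord.qf_eval (set_nth 0 e i t) f1) (ord.qf_eval (set_nth 0 e i t) f2).
  move=> [b1 ab1 h1] [b2 ab2 h2]; exists (Num.min b1 b2).
    by rewrite lt_min ab1.
  move=> s t; rewrite !lt_min => /and3P[? ? ?] /and3P[? ? ?].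
  by congr (op _ _); [apply: h1|apply: h2]; apply/andP.
have atom t1 t2 : GRing.rterm t1 -> GRing.rterm t2 ->
    exists2 b, a < b & forall s t, a < s < b -> a < t < b ->
      Num.sg (GRing.eval (set_nth 0 e i s) t1 - GRing.eval (set_nth 0 e i s) t2)
      = Num.sg (GRing.eval (set_nth 0 e i t) t1
                - GRing.eval (set_nth 0 e i t) t2).
  move=> /(eval_rterm_poly e i)[p hp] /(eval_rterm_poly e i)[q hq].
  have [b ab hb] := poly_sign_right (p - q) a; exists b => // s t hs ht.
  by rewrite !hp !hq -!hornerN -!hornerD; exact: hb.
elim: f => //=.
- by move=> b _ _; exists (a + 1); rewrite ?ltrDl.
- move=> t1 t2 _ /andP[/atom h /h[b ab hb]]; exists b => // s t hs ht.
  by rewrite -subr_eq0 -sgr_eq0 (hb s t)// sgr_eq0 subr_eq0.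
- move=> t1 t2 _ /andP[/atom h /h[b ab hb]]; exists b => // s t hs ht.
  by rewrite -subr_lt0 -sgr_lt0 (hb s t)// sgr_lt0 subr_lt0.
- move=> t1 t2 _ /andP[/atom h /h[b ab hb]]; exists b => // s t hs ht.
  by rewrite -subr_le0 -sgr_le0 (hb s t)// sgr_le0 subr_le0.
- move=> f1 ih1 f2 ih2 /andP[/ih1 {}ih1 /ih2 {}ih2] /andP[/ih1 h1 /ih2 h2].
  exact: (two _ _ andb h1 h2).
- move=> f1 ih1 f2 ih2 /andP[/ih1 {}ih1 /ih2 {}ih2] /andP[/ih1 h1 /ih2 h2].
  exact: (two _ _ orb h1 h2).
- move=> f1 ih1 f2 ih2 /andP[/ih1 {}ih1 /ih2 {}ih2] /andP[/ih1 h1 /ih2 h2].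
  exact: (two _ _ implb h1 h2).
- move=> f1 ih1 /ih1 {}ih1 /ih1 [b ab hb]; exists b => // s t hs ht.
  by rewrite (hb s t).
Qed.

(* Quantifier elimination leaves finitely many polynomial sign conditions in
   [t], each of which is constant on a right neighbourhood of [a]. *)
Lemma definable_right (I : finType) (A : (I -> R) -> R -> Prop) (z : I -> R)
    (a : R) :
  definable (fun w : I + unit -> R => A (w \o inl) (w (inr tt))) ->
  exists2 b, a < b & (forall t, a < t < b -> A z t) \/
                     (forall t, a < t < b -> ~ A z t).
Proof.
move=> hA.
(* Variable 0 is kept for [t] and the parameters are numbered from 1, so that setting entry 0 of [e]
   changes [t] alone. *)
have [f hf] := hA (fun k => if k is inl i then (enum_rank i).+1 else 0%N).
pose e := 0 :: [seq z i | i <- enum I].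
have AE t : A z t <-> ord.holds (set_nth 0 e 0 t) f.
  rewrite -hf; set z' := (X in _ <-> A X _); suff -> : z' = z by [].
  apply/funext => i; rewrite /z' /=; rewrite (nth_map i) -?cardE//.
  by rewrite -enum_val_nth enum_rankK.
pose g := ord.quantifier_elim
    (fun i bc => qe_rcf.qfr_to_formula (@qe_rcf.wproj R i bc)) (ord.to_rform f).
have AE' t : A z t <-> ord.qf_eval (set_nth 0 e 0 t) g.
  by rewrite AE; split=> [/qe_rcf.rcf_satP//|h]; apply/qe_rcf.rcf_satP.
have /andP[gqf gr] : ord.qf_form g && ord.rformula g.
  apply: ord.quantifier_elim_wf (ord.to_rform_rformula f).
  exact: qe_rcf.wf_QE_wproj.
have [b ab hb] := qf_eval_right e 0 a gqf gr.
exists b => //; pose m := (a + b) / 2.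
have mab : a < m < b by rewrite /m !midf_lt.
have [Am|Am] := boolP (ord.qf_eval (set_nth 0 e 0 m) g); [left|right].
  by move=> t tab; apply/AE'; rewrite (hb t m).
by move=> t tab /AE'; rewrite (hb t m)//; apply/negP.
Qed.

End Definability.

(** * Monotonicity of definable functions *)

Section Monotonicity.
Context {R : realType}.

(** Consider the infimum of the points of [[s, t]] where [f] is at most [f t]. The condition on the
    right, a one-sided lower semicontinuity, shows that it is attained; the condition on the left
    would move it further down unless it is [s]. *)
Lemma local_nondecreasing (f : R -> R) (s t : R) : s <= t ->
  (forall u e, s <= u < t -> 0 < e ->
     exists2 c, u < c & forall v, u < v < c -> f u <= f v + e) ->
  (forall u, s < u <= t ->
     exists2 c, c < u & forall v, c < v < u -> f v <= f u) ->
  f s <= f t.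
Proof.
move=> st hr hl.
pose S := [set u | s <= u <= t /\ f u <= f t].
have St : S t by rewrite /S /= st !lexx.
have Slb : lbound S s by move=> u [/andP[]].
have infS : has_inf S by split; [exists t|exists s].
set i := inf S.
have si : s <= i by apply: lb_le_inf => //; exists t.
have it : i <= t by apply: ge_inf => //; exists s.
have fi : f i <= f t.
  have [->//|it'] := eqVneq i t.
  have sit : s <= i < t by rewrite si lt_neqAle it'.
  apply/ler_addgt0Pr => e e0.
  have [c ic hc] := hr i e sit e0.
  have ci : 0 < c - i by rewrite subr_gt0.
  have [u Su] := inf_adherent ci infS.
  rewrite -/i addrC subrK => uc.
  have iu : i <= u by apply: ge_inf => //; exists s.
  have [_ fut] := Su.
  move: iu; rewrite le_eqVlt => /predU1P[->|iu]; first by lra.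
  have := hc u; rewrite iu uc => /(_ isT); lra.
have [->//|si'] := eqVneq s i.
have {}si' : s < i by rewrite lt_neqAle si' si.
have [|c ci hc] := hl i; first by rewrite si'.
pose u := (Num.max s c + i) / 2.
have mi : Num.max s c < i by rewrite gt_max si' ci.
have [mu ui] : Num.max s c < u /\ u < i by rewrite /u !midf_lt.
move: mu; rewrite gt_max => /andP[su cu].
have Su : S u.
  split; first by rewrite (ltW su) (le_trans (ltW ui)).
  by rewrite (le_trans (hc u _))// cu ui.
have : i <= u by apply: ge_inf => //; exists s.
by rewrite leNgt ui.
Qed.

(** Sort the points by the integer part [n] of [1 / e t] and by their cell in the grid of mesh
    [1 / (n + 1)]. Two points of one class are closer than both of their gauges. If no class had two
    points, the interval would be countable, hence of measure zero. *)
Lemma gauge_pair (e : R -> R) (a b : R) : a < b ->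
  (forall t, a < t < b -> 0 < e t) ->
  exists s t, [/\ a < s < b, a < t < b, s < t, t < s + e s & t < s + e t].
Proof.
move=> ab e0; apply: contrapT => nex.
have cnt : countable `]a, b[%classic.
  pose n (t : R) := Num.truncn (e t)^-1.
  pose k (t : R) := Num.floor (t * (n t).+1%:R).
  apply/countable_injP.
  have : {in `]a, b[%classic &, injective (fun t => (n t, k t))}.
    move=> s t; rewrite !inE /= !in_itv /= => sab tab [nst kst].
    have step u v : a < u < b -> a < v < b -> n u = n v -> k u = k v -> ~ u < v.
      move=> uab vab nuv kuv uv; apply: nex; exists u, v.
      have N0 : (0 : R) < (n u).+1%:R by rewrite ltr0n.
      have h w : a < w < b -> n w = n u -> v < u + e w.
        move=> wab nw; have : (e w)^-1 < (n u).+1%:R.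
          by rewrite -nw truncnS_gt.
        rewrite invf_plt ?posrE ?e0// => h.
        have h2 : (v - u) * (n u).+1%:R < 1.
          have := floor_le (u * (n u).+1%:R).
          have := floorD1_gt (v * (n u).+1%:R).
          move: kuv; rewrite /k -nuv => ->; rewrite intrD mulrBl mulr1z.
          lra.
        suff vu : v - u < (n u).+1%:R^-1 by rewrite -ltrBlDl (lt_trans vu).
        by rewrite -[ltRHS]mul1r ltr_pdivlMr.
      by split=> //; apply: h.
    case: (ltgtP s t) => // st; first by case: (step _ _ sab tab nst kst st).
    by case: (step _ _ tab sab (esym nst) (esym kst) st).
  move=> inj; exists (fun t => pickle (n t, k t)) => s t sab tab.
  by move=> /(pcan_inj pickleK)/inj; exact.
have := countable_lebesgue_measure0 cnt.
rewrite lebesgue_measure_itv /= lte_fin ab => /eqP.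
by rewrite -EFinB eqe subr_eq0 gt_eqF.
Qed.

Definition definable_fun (f : R -> R) :=
  definable (fun w : bool -> R => f (w true) = w false).

Lemma definable_fun_le (f : R -> R) (I : finType) (i j : I) :
  definable_fun f -> definable (fun w : I -> R => f (w i) <= f (w j)).
Proof.
move=> df.
have : definable (fun w : I -> R => exists y : bool -> R,
    [/\ f (w i) = y true, f (w j) = y false & y true <= y false]).
  apply: (definable_exists (A := fun (w : I -> R) (y : bool -> R) =>
    [/\ f (w i) = y true, f (w j) = y false & y true <= y false])) => /=.
  apply: (@definable_ext _ _ (fun w : I + bool -> R =>
    f (w (inl i)) = w (inr true) /\ (f (w (inl j)) = w (inr false) /\
      w (inr true) <= w (inr false)))).
    by move=> w; split=> [[? []]|[]].
  apply: definable_and.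
    exact: (definable_reindex
      (fun b : bool => if b then inl i else inr true) df).
  apply: definable_and.
    exact: (definable_reindex
      (fun b : bool => if b then inl j else inr false) df).
  by apply: definable_le; exact: polyfun_var.
apply: definable_ext => w; split=> [[y [-> -> //]]|h].
by exists (fun b => if b then f (w i) else f (w j)).
Qed.

Lemma definable_left (I : finType) (A : (I -> R) -> R -> Prop) (z : I -> R)
    (a : R) :
  definable (fun w : I + unit -> R => A (w \o inl) (w (inr tt))) ->
  exists2 b, b < a & (forall t, b < t < a -> A z t) \/
                     (forall t, b < t < a -> ~ A z t).
Proof.
move=> hA.
have [|b ab hb] := @definable_right R I (fun z t => A z (- t)) z (- a).
  apply: (@definable_ext _ _ (fun w : I + unit -> R =>
    exists u, u = - w (inr tt) /\ A (w \o inl) u)).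
    by move=> w; split=> [[u [-> //]]|h]; exists (- w (inr tt)).
  apply: (definable_existsR (A := fun (w : I + unit -> R) u =>
    u = - w (inr tt) /\ A (w \o inl) u)) => /=.
  apply: definable_and; last first.
    exact: (definable_reindex (fun k : I + unit =>
      match k with inl i => inl (inl i) | inr _ => inr tt end) hA).
  apply: definable_eq; first exact: polyfun_var.
  by apply: polyfunN; exact: polyfun_var.
exists (- b); first by rewrite ltrNl.
case: hb => hb; [left|right] => t /andP[bt ta]; rewrite -[t]opprK; apply: hb.
  by rewrite ltrN2 ta ltrNl.
by rewrite ltrN2 ta ltrNl.
Qed.

(** Being a weak minimum of [f] towards the right ([RG]) and being a weak maximum towards the left
    ([LG]) are definable conditions on [t], so each is constant near [a]. When a condition fails,
    the strict opposite inequality holds on a whole one-sided neighbourhood. Both true or both false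
    gives monotonicity by [local_nondecreasing]; the mixed cases are impossible by [gauge_pair]. *)
Lemma definable_fun_monotone (f : R -> R) (a : R) : definable_fun f ->
  exists2 b, a < b &
    (forall s t, a < s -> s <= t -> t < b -> f s <= f t) \/
    (forall s t, a < s -> s <= t -> t < b -> f t <= f s).
Proof.
move=> df.
pose RG t := exists b, t < b /\ forall s, t < s < b -> f t <= f s.
pose LG t := exists b, b < t /\ forall s, b < s < t -> f s <= f t.
have dle (I : finType) (i j : I) := definable_fun_le i j df.
have dlt (I : finType) (i j : I) : definable (fun w : I -> R => w i < w j).
  by apply: definable_lt; exact: polyfun_var.
have RGN t : ~ RG t -> exists2 b, t < b & forall s, t < s < b -> f s < f t.
  move=> nR; have [b tb [hb|hb]] := definable_right (fun _ : unit => t) t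
    (A := fun z s => f (z tt) <= f s) (dle _ (inl tt) (inr tt)).
    by case: nR; exists b.
  by exists b => // s /hb/negP; rewrite -ltNge.
have LGN t : ~ LG t -> exists2 b, b < t & forall s, b < s < t -> f t < f s.
  move=> nR; have [b tb [hb|hb]] := definable_left (fun _ : unit => t) t
    (A := fun z s => f s <= f (z tt)) (dle _ (inr tt) (inl tt)).
    by case: nR; exists b.
  by exists b => // s /hb/negP; rewrite -ltNge.
have dR : definable (fun w : void + unit -> R => RG (w (inr tt))).
  apply: (definable_existsR (A := fun (w : void + unit -> R) b =>
    w (inr tt) < b /\
    forall s, w (inr tt) < s < b -> f (w (inr tt)) <= f s)) => /=.
  apply: definable_and; first exact: dlt.
  apply: (definable_forallR (A := fun (w : (void + unit) + unit -> R) s =>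
    w (inl (inr tt)) < s < w (inr tt) -> f (w (inl (inr tt))) <= f s)) => /=.
  apply: definable_imp; last exact: dle.
  apply: definable_ext (definable_and (dlt _ (inl (inl (inr tt))) (inr tt))
    (dlt _ (inr tt) (inl (inr tt)))) => w; split=> /andP //.
have dL : definable (fun w : void + unit -> R => LG (w (inr tt))).
  apply: (definable_existsR (A := fun (w : void + unit -> R) b =>
    b < w (inr tt) /\
    forall s, b < s < w (inr tt) -> f s <= f (w (inr tt)))) => /=.
  apply: definable_and; first exact: dlt.
  apply: (definable_forallR (A := fun (w : (void + unit) + unit -> R) s =>
    w (inr tt) < s < w (inl (inr tt)) -> f s <= f (w (inl (inr tt))))) => /=.
  apply: definable_imp; last exact: dle.
  apply: definable_ext (definable_and (dlt _ (inl (inr tt)) (inr tt))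
    (dlt _ (inr tt) (inl (inl (inr tt))))) => w; split=> /andP //.
have [b1 ab1 h1] := definable_right (of_void R) a (A := fun _ => RG) dR.
have [b2 ab2 h2] := definable_right (of_void R) a (A := fun _ => LG) dL.
pose b := Num.min b1 b2; have ab : a < b by rewrite lt_min ab1.
have tb t : a < t < b -> a < t < b1 /\ a < t < b2.
  by rewrite lt_min => /and3P[-> -> ->].
exists b => //.
case: h1 => [h1|h1]; case: h2 => [h2|h2].
- left=> s t as_ st tb'; apply: local_nondecreasing => //.
    move=> u e /andP[su ut] e0.
    have /tb[/h1[c [uc hc]] _] : a < u < b.
      by rewrite (lt_le_trans as_)//= (lt_trans ut).
    by exists c => // v /hc; lra.
  move=> u /andP[su ut].
  have /tb[_ /h2[c [uc hc]]] : a < u < b.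
    by rewrite (lt_trans as_)//= (le_lt_trans ut).
  by exists c.
- exfalso.
  (* Here every point is a local minimum, strict on its left. Two points within each other's gauge
     contradict this; the next case is the same with local maxima. *)
  have /choice[e he] : forall t, exists e, a < t < b -> 0 < e /\
      forall s, (t < s < t + e -> f t <= f s) /\ (t - e < s < t -> f t < f s).
    move=> t; have [tab|] := boolP (a < t < b); last by exists 0.
    have [/h1[c [tc hc]] /h2/LGN[d dt hd]] := tb t tab.
    exists (Num.min (c - t) (t - d)) => _; split.
      by rewrite lt_min !subr_gt0 tc.
    move=> s; split=> /andP[s1 s2].
      by apply: hc; rewrite s1/= (lt_le_trans s2)// -lerBrDl ge_min lexx.
    apply: hd; rewrite s2 andbT (le_lt_trans _ s1)//.
    by rewrite lerBrDl -lerBrDr ge_min lexx orbT.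
  have [|s [t [sab tab st ts tt']]] := gauge_pair ab (e := e).
    by move=> t /he[].
  have [_ /(_ t)[+ _]] := he s sab; rewrite st ts => /(_ isT).
  have [_ /(_ s)[_ +]] := he t tab; rewrite st ltrBlDr tt' => /(_ isT).
  lra.
- exfalso.
  have /choice[e he] : forall t, exists e, a < t < b -> 0 < e /\
      forall s, (t < s < t + e -> f s < f t) /\ (t - e < s < t -> f s <= f t).
    move=> t; have [tab|] := boolP (a < t < b); last by exists 0.
    have [/h1/RGN[c tc hc] /h2[d [dt hd]]] := tb t tab.
    exists (Num.min (c - t) (t - d)) => _; split.
      by rewrite lt_min !subr_gt0 tc.
    move=> s; split=> /andP[s1 s2].
      by apply: hc; rewrite s1/= (lt_le_trans s2)// -lerBrDl ge_min lexx.
    apply: hd; rewrite s2 andbT (le_lt_trans _ s1)//.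
    by rewrite lerBrDl -lerBrDr ge_min lexx orbT.
  have [|s [t [sab tab st ts tt']]] := gauge_pair ab (e := e).
    by move=> t /he[].
  have [_ /(_ t)[+ _]] := he s sab; rewrite st ts => /(_ isT).
  have [_ /(_ s)[_ +]] := he t tab; rewrite st ltrBlDr tt' => /(_ isT).
  lra.
- right=> s t as_ st tb'; rewrite -lerN2.
  apply: (@local_nondecreasing (fun u => - f u) s t) => //.
    move=> u e /andP[su ut] e0.
    have /tb[/h1/RGN[c uc hc] _] : a < u < b.
      by rewrite (lt_le_trans as_)//= (lt_trans ut).
    by exists c => // v /hc; lra.
  move=> u /andP[su ut].
  have /tb[_ /h2/LGN[c uc hc]] : a < u < b.
    by rewrite (lt_trans as_)//= (le_lt_trans ut).
  by exists c => // v /hc; lra.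
Qed.

End Monotonicity.

(** * Definable selections and desingularization *)

Section Selection.
Context {R : realType} {N : nat}.
Implicit Types (A : R -> set 'rV[R]_N) (q : ('I_N -> R) -> R).

Definition definable_family A :=
  definable (fun w : unit + 'I_N -> R => A (w (inl tt)) (\row_i w (inr i))).

Definition minimizers q A (t : R) : set 'rV[R]_N :=
  [set z | A t z /\ forall z', A t z' -> q (z 0) <= q (z' 0)].

Lemma row_fun (y : 'I_N -> R) : (\row_i y i) 0 = y.
Proof. by apply/funext => i; rewrite mxE. Qed.

Lemma row_eta (z : 'rV[R]_N) : \row_i z 0 i = z.
Proof. by apply/rowP => i; rewrite mxE. Qed.

Lemma minimizers_definable q A :
  polyfun q -> definable_family A -> definable_family (minimizers q A).
Proof.
move=> hq hA; apply: definable_and => //.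
apply: (@definable_ext _ _ (fun w : unit + 'I_N -> R =>
  forall y : 'I_N -> R, A (w (inl tt)) (\row_i y i) -> q (w \o inr) <= q y)).
  move=> w; split=> [h z' Az'|h y Ay].
    rewrite row_fun; apply: (h (z' 0)); by rewrite row_eta.
  by have := h _ Ay; rewrite !row_fun.
apply: (definable_forall (A := fun (w : unit + 'I_N -> R) (y : 'I_N -> R) =>
  A (w (inl tt)) (\row_i y i) -> q (w \o inr) <= q y)) => /=.
apply: definable_imp.
  exact: (definable_reindex (fun k : unit + 'I_N =>
    match k with inl u => inl (inl u) | inr i => inr i end) hA).
by apply: definable_le; exact: polyfun_reindex hq.
Qed.

Lemma minimizers_compact q A t : polyfun q -> compact (A t) ->
  compact (minimizers q A t) /\ (A t !=set0 -> minimizers q A t !=set0).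
Proof.
move=> /polyfun_continuous qc cA; have [A0|/set0P A0] := eqVneq (A t) set0.
  rewrite A0; split=> [|[]//]; suff -> : minimizers q A t = set0.
    exact: compact0.
  by rewrite -subset0 => z [+ _]; rewrite A0.
have [z0] := compact_EVT_min A0 cA (continuous_subspaceT qc).
rewrite inE => Az0 z0min.
have -> : minimizers q A t =
    A t `&` (fun z : 'rV[R]_N => q (z 0)) @^-1` [set x | x <= q (z0 0)].
  apply/seteqP; split=> z [Az]; first by move=> /(_ z0 Az0).
  move=> /= qz; split=> // z' Az'; apply: (le_trans qz).
  by apply: z0min; rewrite inE.
split=> [|_]; last by exists z0; split => /=.
apply: compact_closedI => //; apply: preimage_closed.
  by move=> z _; exact: qc.
exact: closed_le.
Qed.

(* Minimizing the coordinates one after the other leaves a single point. *)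
Lemma definable_selection A :
  definable_family A -> (forall t, compact (A t)) ->
  exists z : R -> 'rV[R]_N, (forall t, A t !=set0 -> A t (z t)) /\
    forall i, definable_fun (fun t => z t 0 i).
Proof.
move=> dA cA.
have [B [BA dB B0 Bi]] : exists B : R -> set 'rV[R]_N,
    [/\ forall t, B t `<=` A t, definable_family B,
      forall t, A t !=set0 -> B t !=set0 &
      forall t z z', B t z -> B t z' -> z = z'].
  suff [B [BA dB _ [B0 Bi]]] : exists B : R -> set 'rV[R]_N,
      [/\ forall t, B t `<=` A t, definable_family B, forall t, compact (B t) &
        (forall t, A t !=set0 -> B t !=set0) /\
        forall t z z' i, i \in enum 'I_N -> B t z -> B t z' -> z 0 i = z' 0 i].
    exists B; split=> // t z z' Bz Bz'.
    by apply/rowP => i; apply: (Bi t); rewrite ?mem_enum.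
  elim: (enum 'I_N) => [|i s [B [BA dB cB [B0 Bi]]]].
    by exists A; split=> // t; exact: subset_refl.
  exists (minimizers (fun w => w i) B).
  have qc := @polyfun_var R _ i.
  split.
  - by move=> t z [/BA].
  - by apply: minimizers_definable => //; exact: polyfun_var.
  - by move=> t; have [] := minimizers_compact (q := fun w => w i) qc (cB t).
  split=> [t /B0|t z z' j].
    by have [_] := minimizers_compact (q := fun w => w i) qc (cB t).
  rewrite inE => /predU1P[->|js] [Bz zmin] [Bz' z'min]; last exact: (Bi t).
  by apply/eqP; rewrite eq_le zmin ?z'min.
(* The fixed value 0 at the empty levels keeps the graph of each coordinate definable: it is the
   union of [dne] and [de]. *)
have /choice[z hz] : forall t, exists z,
    (B t !=set0 -> B t z) /\ (~ (B t !=set0) -> z = 0).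
  move=> t; have [[z Bz]|nB] := pselect (B t !=set0).
    by exists z; split=> // nB; exfalso; apply: nB; exists z.
  by exists 0; split.
exists z; split=> [t /B0/(hz t).1/BA//|i].
have dne : definable (fun w : bool -> R =>
    exists y : 'I_N -> R, B (w true) (\row_i y i) /\ y i = w false).
  apply: (definable_exists (A := fun (w : bool -> R) (y : 'I_N -> R) =>
    B (w true) (\row_i y i) /\ y i = w false)) => /=.
  apply: definable_and; last by apply: definable_eq; exact: polyfun_var.
  exact: (definable_reindex (fun k : unit + 'I_N =>
    match k with inl _ => inl true | inr i => inr i end) dB).
have de : definable (fun w : bool -> R =>
    (forall y : 'I_N -> R, ~ B (w true) (\row_i y i)) /\ w false = 0).
  apply: definable_and; last first.
    by apply: definable_eq; [exact: polyfun_var|exact: polyfun_cst].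
  apply: (definable_forall (A := fun (w : bool -> R) (y : 'I_N -> R) =>
    ~ B (w true) (\row_i y i))) => /=.
  apply: definable_not.
  exact: (definable_reindex (fun k : unit + 'I_N =>
    match k with inl _ => inl true | inr i => inr i end) dB).
apply: definable_ext (definable_or dne de) => w; have [zB zN] := hz (w true).
split=> [[[y [By <-]]|[nB ->]]|zw].
- have Bz : B (w true) (z (w true)) by apply: zB; exists (\row_i y i).
  by rewrite (Bi _ _ _ Bz By) mxE.
- rewrite zN ?mxE// => -[u Bu]; apply: (nB (u 0)); by rewrite row_eta.
- have [Bn0|nB] := pselect (B (w true) !=set0); [left|right].
    by exists (z (w true) 0); rewrite row_eta; split=> //; exact: zB.
  split=> [y By|]; first by apply: nB; exists (\row_i y i).
  by rewrite -zw zN// mxE.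
Qed.

Lemma definable_fun_poly (z : 'I_N -> R -> R) q :
  (forall i, definable_fun (z i)) -> polyfun q ->
  definable_fun (fun t => q (fun i => z i t)).
Proof.
move=> dz hq.
have : definable (fun w : bool -> R => exists y : 'I_N -> R,
    (forall i, i \in enum 'I_N -> z i (w true) = y i) /\ q y = w false).
  apply: (definable_exists (A := fun (w : bool -> R) (y : 'I_N -> R) =>
    (forall i, i \in enum 'I_N -> z i (w true) = y i) /\ q y = w false)) => /=.
  apply: definable_and.
    apply: (@definable_all_seq _ _ _ (enum 'I_N)
      (fun i (w : bool + 'I_N -> R) => z i (w (inl true)) = w (inr i))) => i.
    exact: (definable_reindex
      (fun b : bool => if b then inl true else inr i) (dz i)).
  apply: definable_eq; last exact: polyfun_var.
  exact: polyfun_reindex hq.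
apply: definable_ext => w; split=> [[y [zy <-]]|qw].
  by congr q; apply/funext => i; rewrite zy ?mem_enum.
by exists (fun i => z i (w true)).
Qed.

End Selection.

Section Desingularization.
Context {R : realType} {N : nat}.
Implicit Types (A : R -> set 'rV[R]_N) (q : ('I_N -> R) -> R).

(* At a jump of [Phi] the quadratic term is controlled by taking [v] so close
   to [u] that [u - v] is below the threshold [2 (C rho)^2 / K]. *)
Lemma slope_increment (D : R -> R -> R) (Phi : R -> R) (C K rho s t : R) :
  0 < C -> 0 < K -> 0 < rho -> s <= t ->
  (forall u v, s <= u -> u <= v -> v <= t -> Phi u <= Phi v) ->
  (forall u v, s <= u -> u < v -> v <= t ->
     [/\ 0 <= D u v, D u v <= Phi v - Phi u &
      v - u <= C * rho * D u v + K * D u v ^+ 2]) ->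
  t - s <= 2 * C * rho * (Phi t - Phi s).
Proof.
move=> C0 K0 r0 st Phi_nd hD.
set k := C * rho; have k0 : 0 < k by rewrite mulr_gt0.
suff : 2 * k * Phi s - s <= 2 * k * Phi t - t.
  by rewrite -(mulrA 2 C rho) -/k mulrBr; lra.
apply: (@local_nondecreasing _ (fun u => 2 * k * Phi u - u)) => //.
  (* To the right of [u] monotonicity of [Phi] suffices, since the slack [e] pays for [v - u]. *)
  move=> u e /andP[su ut] e0; exists (Num.min t (u + e)).
    by rewrite lt_min ut ltrDl.
  move=> v /andP[uv]; rewrite lt_min => /andP[vt vue].
  have := Phi_nd _ _ su (ltW uv) (ltW vt).
  rewrite -(ler_pM2l (_ : 0 < 2 * k)) ?mulr_gt0//; lra.
move=> u /andP[su ut].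
pose d := 2 * k ^+ 2 / K.
have d0 : 0 < d by rewrite divr_gt0// mulr_gt0// exprn_gt0.
exists (Num.max s (u - d)); first by rewrite gt_max su ltrBlDr ltrDl.
move=> v /andP[]; rewrite gt_max => /andP[sv uvd] vu.
have [] := hD _ _ (ltW sv) vu ut; set x := D v u => x0 xPhi hx.
suff : u - v <= 2 * k * x.
  move: xPhi; rewrite -(ler_pM2l (_ : 0 < 2 * k)) ?mulr_gt0// mulrBr; lra.
(* If [K * x <= k], the quadratic term is at most [k * x]. Otherwise [x] exceeds [k / K], and
   [2 * k * x] exceeds [d], which bounds [u - v]. *)
have [Kx|Kx] := leP (K * x) k.
  apply: (le_trans hx); rewrite expr2 mulrA -/k.
  have := ler_wpM2r x0 Kx; lra.
have : u - v <= d by lra.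
move=> /le_trans; apply; rewrite /d expr2 ler_pdivrMr//.
have := ler_wpM2l (ltW k0) (ltW Kx); nra.
Qed.

(** If the minimal squared slope [r] is nondecreasing, a bound on it at [t] is valid on all of []s,
    t]], and [slope_increment] applies with the variation of the selection as [Phi]. If [r] is
    nonincreasing, it stays above a positive constant near [a], and an affine [Phi] is enough. If
    the levels just above [a] are empty, there is nothing to prove. *)
Lemma desingularization A q (C K B a : R) :
  0 < C -> 0 < K -> definable_family A -> (forall t, compact (A t)) ->
  (forall t z i, A t z -> `|z 0 i| <= B) ->
  polyfun q -> (forall w, 0 <= q w) ->
  (forall s t z z' rho, s < t -> A t z -> A s z' -> 0 < rho ->
     q (z 0) <= rho ^+ 2 ->
     t - s <= C * rho * (\sum_i `|z 0 i - z' 0 i|)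
              + K * (\sum_i `|z 0 i - z' 0 i|) ^+ 2) ->
  exists b (Phi : R -> R) M C', [/\ a < b, 0 < C',
    forall t, a < t < b -> 0 <= Phi t <= M &
    forall s t z rho, a < s -> s < t -> t < b -> A t z -> 0 < rho ->
      q (z 0) <= rho ^+ 2 -> t - s <= C' * rho * (Phi t - Phi s)].
Proof.
move=> C0 K0 dA cA AB hq q0 slope.
have dne : definable (fun w : void + unit -> R => A (w (inr tt)) !=set0).
  apply: (@definable_ext _ _ (fun w : void + unit -> R =>
    exists y : 'I_N -> R, A (w (inr tt)) (\row_i y i))).
    move=> w; split=> [[y Ay]|[z Az]]; first by exists (\row_i y i).
    by exists (z 0); rewrite row_eta.
  apply: (definable_exists (A := fun (w : void + unit -> R) (y : 'I_N -> R) =>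
    A (w (inr tt)) (\row_i y i))) => /=.
  exact: (definable_reindex (fun k : unit + 'I_N =>
    match k with inl _ => inl (inr tt) | inr i => inr i end) dA).
have [b0 ab0 [An0|A0]] := definable_right (of_void R) a
    (A := fun _ t => A t !=set0) dne; last first.
  exists b0, (fun=> 0), 0, 1; split=> // [t _|s t z rho as_ st tb Az].
    by rewrite lexx.
  by exfalso; apply: (A0 t); [rewrite (lt_trans as_)|exists z].
have mcpt t := minimizers_compact (t := t) hq (cA t).
have [z [hz dz]] := definable_selection (minimizers_definable hq dA)
  (fun t => (mcpt t).1).
have {}hz t : a < t < b0 -> minimizers q A t (z t).
  by move=> /An0 ?; apply/hz/(mcpt t).2.
pose r t := q (z t 0).
have dr : definable_fun r := definable_fun_poly dz hq.
have [b1 ab1 hmono] : exists2 b1, a < b1 & forall i, i \in enum 'I_N ->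
    (forall s t, a < s -> s <= t -> t < b1 -> z s 0 i <= z t 0 i) \/
    (forall s t, a < s -> s <= t -> t < b1 -> z t 0 i <= z s 0 i).
  elim: (enum 'I_N) => [|i e [b1 ab1 hb1]].
    by exists (a + 1); rewrite ?ltrDl.
  have [b2 ab2 hb2] := definable_fun_monotone a (dz i).
  exists (Num.min b1 b2); first by rewrite lt_min ab1.
  move=> j; rewrite inE => /predU1P[->|/hb1 hj].
    by case: hb2 => h; [left|right] => s t as_ st; rewrite lt_min => /andP[_];
      exact: h.
  by case: hj => h; [left|right] => s t as_ st; rewrite lt_min => /andP[+ _];
    exact: h.
have [b2 ab2 rmono] := definable_fun_monotone a dr.
pose b := Num.min b0 (Num.min b1 b2).
have ab : a < b by rewrite !lt_min ab0 ab1.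
have bb0 : b <= b0 by rewrite ge_min lexx.
have bb1 : b <= b1 by rewrite !ge_min lexx orbT.
have bb2 : b <= b2 by rewrite !ge_min lexx !orbT.
have /choice[eps heps] : forall i, exists eps : R, `|eps| = 1 /\
    forall s t, a < s -> s <= t -> t < b ->
      `|z t 0 i - z s 0 i| = eps * z t 0 i - eps * z s 0 i.
  move=> i; have [//|h|h] := hmono i; first by rewrite mem_enum.
    exists 1; split=> [|s t as_ st tb]; first by rewrite normr1.
    by rewrite !mul1r ger0_norm// subr_ge0; apply: h => //;
      exact: lt_le_trans bb1.
  exists (-1); split=> [|s t as_ st tb]; first by rewrite normrN normr1.
  rewrite !mulN1r ler0_norm ?subr_le0; first by rewrite opprB opprK addrC.
  by apply: h => //; exact: lt_le_trans bb1.
(* The sign [eps i] makes each coordinate nondecreasing, so increments of [Phi] are distances in the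
   sum norm; adding [B] makes every term nonnegative. *)
pose Phi t := \sum_i (eps i * z t 0 i + B).
have Phi_sub s t : a < s -> s <= t -> t < b ->
    Phi t - Phi s = \sum_i `|z t 0 i - z s 0 i|.
  move=> as_ st tb; rewrite /Phi -sumrB; apply: eq_bigr => i _.
  by rewrite (heps i).2//; lra.
have Phi_nd s t : a < s -> s <= t -> t < b -> Phi s <= Phi t.
  by move=> as_ st tb; rewrite -subr_ge0 Phi_sub// sumr_ge0.
have Phi_bnd t : a < t < b -> 0 <= Phi t <= \sum_(i < N) (2 * B).
  move=> /andP[at_ tb].
  have h i : `|eps i * z t 0 i| <= B.
    rewrite normrM (heps i).1 mul1r; apply: (AB t).
    by apply: (hz t _).1; rewrite at_ (lt_le_trans tb).
  have {}h i : - B <= eps i * z t 0 i <= B by rewrite -ler_norml.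
  apply/andP; split; first by apply: sumr_ge0 => i _; move: (h i); lra.
  by apply: ler_sum => i _; move: (h i); lra.
have key s t rho : a < s -> s < t -> t < b -> 0 < rho ->
    (forall u, s < u <= t -> r u <= rho ^+ 2) ->
    t - s <= 2 * C * rho * (Phi t - Phi s).
  move=> as_ st tb rho0 hr.
  apply: (@slope_increment (fun u v => \sum_i `|z v 0 i - z u 0 i|) Phi C K)
    => //; first exact: ltW.
    by move=> u v su uv vt; apply: Phi_nd => //; [exact: lt_le_trans su|
      exact: le_lt_trans tb].
  move=> u v su uv vt; have au : a < u by exact: lt_le_trans su.
  have vb : v < b by exact: le_lt_trans tb.
  split; first exact: sumr_ge0.
    by rewrite -Phi_sub// ltW.
  have zu : minimizers q A u (z u).
    by apply: hz; rewrite au (lt_le_trans _ bb0)// (lt_trans uv).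
  have zv : minimizers q A v (z v).
    by apply: hz; rewrite (lt_trans au)// (lt_le_trans _ bb0).
  apply: slope => //; [exact: zv.1|exact: zu.1|].
  by apply: hr; rewrite (le_lt_trans su).
have rmin t z0 : a < t -> t < b -> A t z0 -> r t <= q (z0 0).
  move=> at_ tb Az0; apply: (hz t _).2 => //.
  by rewrite at_ (lt_le_trans tb).
case: rmono => rmono.
  exists b, Phi, (\sum_(i < N) (2 * B)), (2 * C); split=> //.
    by rewrite mulr_gt0.
  move=> s t z0 rho as_ st tb Az0 rho0 qrho; apply: key => // u /andP[su ut].
  apply: le_trans qrho; apply: le_trans (rmin t z0 _ tb Az0).
    by apply: rmono => //; [exact: lt_trans su|exact: lt_le_trans bb2].
  exact: lt_trans st.
pose t1 := (a + b) / 2; have [at1 t1b] : a < t1 /\ t1 < b by rewrite !midf_lt.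
(* A Sard-type argument: if [r] vanished at [t1], it would vanish on [[t1, t2]], [key] would hold
   there for every positive [rho], and [rho] tending to 0 would give [t2 <= t1]. *)
have rt1 : 0 < r t1.
  rewrite lt_neqAle q0 andbT eq_sym; apply/eqP => rt1.
  pose t2 := (t1 + b) / 2.
  have [t12 t2b] : t1 < t2 /\ t2 < b by rewrite !midf_lt.
  have h rho : 0 < rho -> t2 - t1 <= 2 * C * rho * (Phi t2 - Phi t1).
    move=> rho0; apply: key => // u /andP[t1u ut2].
    apply: (@le_trans _ _ (r t1)); last by rewrite rt1 sqr_ge0.
    by apply: rmono => //; [exact: ltW|
      exact: le_lt_trans ut2 (lt_le_trans t2b bb2)].
  have P0 : 0 <= Phi t2 - Phi t1 by rewrite subr_ge0 Phi_nd// ltW.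
  pose X := 2 * C * (Phi t2 - Phi t1 + 1).
  have X0 : 0 < X by rewrite !mulr_gt0// ltr_wpDl.
  (* This [rho] makes the right-hand side at most [(t2 - t1) / 2]; the [+ 1] in [X] avoids a
     division by zero. *)
  have := h ((t2 - t1) / 2 / X).
  rewrite !divr_gt0 ?subr_gt0// => /(_ isT).
  have -> : 2 * C * ((t2 - t1) / 2 / X) * (Phi t2 - Phi t1) =
      (t2 - t1) / 2 * ((Phi t2 - Phi t1) / (Phi t2 - Phi t1 + 1)).
    rewrite /X; field; rewrite !gt_eqF// ltr_wpDl//.
  have : (Phi t2 - Phi t1) / (Phi t2 - Phi t1 + 1) <= 1.
    by rewrite ler_pdivrMr ?ltr_wpDl// mul1r lerDl.
  have t120 : 0 < (t2 - t1) / 2 by rewrite divr_gt0// subr_gt0.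
  move=> /(ler_wpM2l (ltW t120)); rewrite mulr1; lra.
(* Below [t1] every admissible [rho] is at least [Num.sqrt (r t1)]. *)
exists t1, (fun t => t - a), (t1 - a), (Num.sqrt (r t1))^-1.
have sr0 : 0 < Num.sqrt (r t1) by rewrite sqrtr_gt0.
split=> //; first by rewrite invr_gt0.
  by move=> t /andP[at_ tt1]; rewrite subr_ge0 (ltW at_) lerD2r ltW.
move=> s t z0 rho as_ st tt1 Az0 rho0 qrho.
have srho : Num.sqrt (r t1) <= rho.
  rewrite -(ger0_norm (ltW rho0)) -sqrtr_sqr ler_sqrt ?sqr_ge0//.
  apply: le_trans qrho; apply: le_trans (rmin t z0 _ (lt_trans tt1 t1b) Az0).
    apply: rmono => //; [exact: lt_trans st|exact: ltW|exact: lt_le_trans bb2].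
  exact: lt_trans st.
have -> : t - a - (s - a) = t - s by lra.
by rewrite ler_peMl ?subr_ge0 ?(ltW st)// [leRHS]mulrC ler_pdivlMr// mul1r.
Qed.

End Desingularization.

(** * Functions with a Lipschitz gradient *)

Section Euclidean.
Context {R : realType} {m : nat}.
Implicit Types (u v w x y : 'rV[R]_m) (a : R).

Lemma dotpC u v : dotp u v = dotp v u.
Proof. by apply: eq_bigr => i _; rewrite mulrC. Qed.

Lemma dotpDl u v w : dotp (u + v) w = dotp u w + dotp v w.
Proof. by rewrite -big_split; apply: eq_bigr => i _; rewrite mxE mulrDl. Qed.

Lemma dotpZl a u v : dotp (a *: u) v = a * dotp u v.
Proof. by rewrite mulr_sumr; apply: eq_bigr => i _; rewrite mxE mulrA. Qed.

Lemma dotpNl u v : dotp (- u) v = - dotp u v.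
Proof. by rewrite -scaleN1r dotpZl mulN1r. Qed.

Lemma dotpBl u v w : dotp (u - v) w = dotp u w - dotp v w.
Proof. by rewrite dotpDl dotpNl. Qed.

Lemma dotpDr u v w : dotp w (u + v) = dotp w u + dotp w v.
Proof. by rewrite !(dotpC w) dotpDl. Qed.

Lemma dotpZr a u v : dotp u (a *: v) = a * dotp u v.
Proof. by rewrite !(dotpC u) dotpZl. Qed.

Lemma dotpNr u v : dotp u (- v) = - dotp u v.
Proof. by rewrite !(dotpC u) dotpNl. Qed.

Lemma dotpBr u v w : dotp w (u - v) = dotp w u - dotp w v.
Proof. by rewrite !(dotpC w) dotpBl. Qed.

Definition dotpE := (dotpDl, dotpDr, dotpNl, dotpNr, dotpZl, dotpZr).

Lemma dotp_ge0 u : 0 <= dotp u u.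
Proof. by apply: sumr_ge0 => i _; rewrite -expr2 sqr_ge0. Qed.

Lemma enorm_ge0 u : 0 <= enorm u. Proof. exact: sqrtr_ge0. Qed.

Lemma sqr_enorm u : enorm u ^+ 2 = dotp u u.
Proof. by rewrite sqr_sqrtr// dotp_ge0. Qed.

Lemma enormN u : enorm (- u) = enorm u.
Proof. by rewrite /enorm dotpNl dotpNr opprK. Qed.

Lemma enormB u v : enorm (u - v) = enorm (v - u).
Proof. by rewrite -enormN opprB. Qed.

Lemma enormZ a u : enorm (a *: u) = `|a| * enorm u.
Proof.
rewrite /enorm dotpZl dotpZr mulrA -expr2 sqrtrM ?sqr_ge0//.
by rewrite sqrtr_sqr.
Qed.

Lemma coord_le_enorm u i : `|u 0 i| <= enorm u.
Proof.
rewrite -sqrtr_sqr ler_sqrt ?dotp_ge0// /dotp (bigD1 i)//= expr2 lerDl.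
by apply: sumr_ge0 => j _; rewrite -expr2 sqr_ge0.
Qed.

Lemma enorm_eq0 u : enorm u = 0 -> u = 0.
Proof.
move=> u0; apply/rowP => i; rewrite mxE; apply/eqP; rewrite -normr_eq0.
by rewrite eq_le normr_ge0 -u0 coord_le_enorm.
Qed.

Lemma dotp_le u v : dotp u v <= enorm u * enorm v.
Proof.
have [u0|u0] := eqVneq (enorm u) 0.
  rewrite u0 (enorm_eq0 u0) mul0r /dotp big1// => i _; by rewrite mxE mul0r.
have [v0|v0] := eqVneq (enorm v) 0.
  rewrite v0 (enorm_eq0 v0) mulr0 /dotp big1// => i _; by rewrite mxE mulr0.
have {}u0 : 0 < enorm u by rewrite lt_neqAle eq_sym u0 enorm_ge0.
have {}v0 : 0 < enorm v by rewrite lt_neqAle eq_sym v0 enorm_ge0.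
have := dotp_ge0 (enorm v *: u - enorm u *: v).
rewrite !dotpE -!sqr_enorm (dotpC v u).
set a := enorm u; set b := enorm v; set d := dotp u v.
rewrite [X in 0 <= X](_ : _ = 2 * (a * b) * (a * b - d)); last by ring.
by rewrite pmulr_rge0 ?subr_ge0// !mulr_gt0.
Qed.

Lemma enormD u v : enorm (u + v) <= enorm u + enorm v.
Proof.
rewrite -(ler_pXn2r (ltn0Sn 1)) ?nnegrE ?addr_ge0 ?enorm_ge0//.
rewrite sqr_enorm !dotpE sqrrD !sqr_enorm (dotpC v u).
have := dotp_le u v; lra.
Qed.

Lemma norm_le_enorm u : `|u| <= enorm u.
Proof.
rewrite [leLHS]/Num.norm /= mx_normrE; apply/bigmax_leP.
split; first exact: enorm_ge0.
by move=> [i j] _ /=; rewrite ord1 coord_le_enorm.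
Qed.

Lemma enorm_le_sum u : enorm u <= \sum_i `|u 0 i|.
Proof.
have s0 : 0 <= \sum_i `|u 0 i| by apply: sumr_ge0.
rewrite -(ler_pXn2r (ltn0Sn 1)) ?nnegrE ?enorm_ge0// sqr_enorm expr2 mulr_suml.
apply: ler_sum => i _; rewrite -expr2 -real_normK ?num_real// expr2.
by rewrite ler_wpM2l// (bigD1 i)//= lerDl sumr_ge0.
Qed.

Lemma enorm_le_norm u : enorm u <= m%:R * `|u|.
Proof.
apply: (le_trans (enorm_le_sum u)).
rewrite -[X in X%:R]card_ord -sum1_card natr_sum mulr_suml.
apply: ler_sum => i _; rewrite mul1r [leRHS]/Num.norm /= mx_normrE.
by apply/bigmax_geP; right; exists (0, i).
Qed.

End Euclidean.

Section LipschitzGradient.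
Context {R : realType} {m : nat}.
Implicit Types (g F : 'rV[R]_m -> R) (x y d : 'rV[R]_m).

Lemma diff_grad g x d : differentiable g x -> 'd g x d = dotp (grad g x) d.
Proof.
move=> dg; rewrite [in LHS](matrix_sum_delta d) big_ord1 linear_sum /=.
by apply: eq_bigr => i _; rewrite linearZ /= mxE mulrC.
Qed.

Lemma is_derive_line g x d s : differentiable g (x + s *: d) ->
  is_derive s 1 (fun r : R => g (x + r *: d) : R)
    (dotp (grad g (x + s *: d)) d).
Proof.
move=> dg; have E : (fun h : R => h^-1 *:
      (((fun r : R => g (x + r *: d)) \o shift s) (h *: (1 : R)) - g (x + s *: d))) =
    (fun h : R => h^-1 *:
      ((g \o shift (x + s *: d)) (h *: d) - g (x + s *: d))).
  apply/funext => h /=; rewrite /shift /=; congr (_ *: (g _ - _)).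
  by rewrite [h *: 1]mulr1 scalerDl addrCA.
split.
  by rewrite /derivable E; exact: diff_derivable.
by rewrite /derive E -[LHS]/('D_d g (x + s *: d)) deriveE// diff_grad.
Qed.

(** Instead of integrating the gradient along the segment, subtract the claimed quadratic bound: the
    difference [psi] has nonpositive derivative on []0, 1[], and the mean value theorem compares its
    end values. *)
Lemma descent_lemma L g x y : (forall z, differentiable g z) ->
  lipschitz_gradient L g ->
  g y <= g x + dotp (grad g x) (y - x) + L / 2 * enorm (y - x) ^+ 2.
Proof.
move=> dg Lg; set d := y - x; have xdy : x + d = y by rewrite addrC subrK.
pose a := dotp (grad g x) d; pose c := L / 2 * enorm d ^+ 2.
pose psi : R -> R := (fun s : R => g (x + s *: d) : R)
  - (cst a * id + cst c * (id ^+ 2)).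
pose dpsi (s : R) := dotp (grad g (x + s *: d)) d - (a + 2 * c * s).
have dp (s : R) : is_derive s (1 : R) psi (dpsi s).
  have h := is_derive_line (dg (x + s *: d)).
  apply: is_derive_eq; rewrite /dpsi; congr (_ - _).
  by rewrite /cst /= !scaler0 /GRing.scale /=; ring.
have psic : {within `[0, 1], continuous psi}.
  apply: continuous_subspaceT => s.
  by apply/differentiable_continuous/derivable1_diffP; have [] := dp s.
have [r] := MVT (ltr01) (fun s _ => dp s) psic.
rewrite in_itv /= => /andP[r0 r1]; rewrite subr0 mulr1.
have -> : psi 1 = g y - (a + c).
  rewrite /psi !fctE /cst /= scale1r expr1n !mulr1.
  by rewrite xdy.
have -> : psi 0 = g x.
  rewrite /psi !fctE /cst /= scale0r addr0 expr0n /= !mulr0 addr0 subr0 //.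
have : dpsi r <= 0.
  rewrite /dpsi opprD addrA /a -dotpBl subr_le0.
  apply: (le_trans (dotp_le _ _)).
  have rd : x + r *: d - x = r *: d by rewrite addrC addKr.
  have h := Lg (x + r *: d) x; rewrite rd enormZ gtr0_norm// in h.
  apply: (le_trans (ler_wpM2r (enorm_ge0 d) h)).
  by rewrite /c le_eqVlt; apply/orP; left; apply/eqP; field.
rewrite /a /c; lra.
Qed.

Lemma grad_opp g x : differentiable g x -> grad (fun z => - g z) x = - grad g x.
Proof.
move=> dg; apply/rowP => i; rewrite !mxE.
by rewrite (_ : (fun z => - g z) = - g)// diffN.
Qed.

Lemma descent_lemma_ge L g x y : (forall z, differentiable g z) ->
  lipschitz_gradient L g ->
  g x + dotp (grad g x) (y - x) - L / 2 * enorm (y - x) ^+ 2 <= g y.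
Proof.
move=> dg Lg.
have := @descent_lemma L (fun z => - g z) x y; rewrite grad_opp// dotpNl.
suff [dNg LNg] : (forall z, differentiable (fun z => - g z) z) /\
    lipschitz_gradient L (fun z => - g z) by move=> /(_ dNg LNg); lra.
split=> [z|u v]; first exact: differentiableN.
by rewrite !grad_opp// -opprD enormN.
Qed.

(* Letting [t] tend to [0] in the convexity inequality between [y] and
   [y + t (x - y)]. *)
Lemma strongly_convex_bregman sigma L F x y : 0 < sigma -> 0 < L ->
  strongly_convex sigma F -> (forall z, differentiable F z) ->
  lipschitz_gradient L F ->
  sigma / 2 * enorm (x - y) ^+ 2 <= bregman F x y.
Proof.
move=> s0 L0 sF dF LF; set e := enorm (x - y) ^+ 2.
have e0 : 0 <= e by exact: sqr_ge0.
have step (t : R) : 0 < t -> t < 1 ->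
    sigma / 2 * (1 - t) * e - L / 2 * t * e <= bregman F x y.
  move=> t0 t1.
  have h : F (t *: x + (1 - t) *: y)
      - sigma / 2 * enorm (t *: x + (1 - t) *: y) ^+ 2 <=
      t * (F x - sigma / 2 * enorm x ^+ 2)
      + (1 - t) * (F y - sigma / 2 * enorm y ^+ 2).
    by apply: (sF (Itv01 (ltW t0) (ltW t1)) x y); rewrite inE.
  have xyE : t *: x + (1 - t) *: y = y + t *: (x - y).
    by rewrite scalerBl scale1r scalerBr addrCA addrA.
  (* The gradient at [y] enters through a quadratic minorant rather than a limit of difference
     quotients; after division by [t] the error is [L / 2 * t * e]. *)
  have := descent_lemma_ge y (y + t *: (x - y)) dF LF.
  have yd : y + t *: (x - y) - y = t *: (x - y) by rewrite addrC addKr.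
  rewrite yd -xyE dotpZr enormZ (gtr0_norm t0) exprMn -/e.
  have eE : e = enorm x ^+ 2 - 2 * dotp x y + enorm y ^+ 2.
    by rewrite /e !sqr_enorm !dotpE (dotpC y x); ring.
  move: h; rewrite [enorm (t *: x + _) ^+ 2]sqr_enorm !dotpE (dotpC y x).
  rewrite -!sqr_enorm /bregman.
  set f1 := F (_ + _); set X := enorm x ^+ 2 in eE *.
  set Y := enorm y ^+ 2 in eE *; set p := dotp x y in eE *.
  set gd := dotp (grad F y) (x - y) => h1 h2.
  rewrite -(ler_pM2l t0).
  by move: h1 h2; rewrite eE /gd dotpBr; lra.
apply/ler_addgt0Pr => d d0.
pose k := (sigma / 2 + L / 2) * e + 1.
have k0 : 0 < k by rewrite ltr_wpDl// mulr_ge0// addr_ge0// divr_ge0// ltW.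
pose t := Num.min (d / k) (1 / 2).
have t0 : 0 < t by rewrite lt_min !divr_gt0.
have t1 : t < 1 by rewrite gt_min; apply/orP; right; lra.
have tk : t * k <= d by rewrite -ler_pdivlMr// ge_min lexx.
have := step t t0 t1; move: tk; rewrite /k; nra.
Qed.
End LipschitzGradient.

(** * One step of the algorithm *)

(* Reification compares atoms up to conversion, which is too slow on these. *)
Ltac generalize_reals :=
  repeat match goal with
  | |- context [dotp ?x ?y] => generalize (dotp x y); intro
  | |- context [bregman ?F ?x ?y] => generalize (bregman F x y); intro
  | |- context [enorm ?x] => generalize (enorm x); intro
  end.

Section AlgorithmStep.
#[local] Opaque grad dotp enorm.
Context {R : realType} {m : nat}.
Implicit Types (x y u v : 'rV[R]_m) (h : 'rV[R]_m -> \bar R).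

Definition proximal_subgradient (K : R) h x v :=
  forall u, (h x + (dotp v (u - x) - K * enorm (u - x) ^+ 2)%:E <= h u)%E.

Variables (f : 'rV[R]_m -> \bar R) (g F : 'rV[R]_m -> R).
Variables (sigma Lg LF : R).
Hypothesis f_proper : proper_fun f.
Hypothesis g_diff : forall y, differentiable g y.
Hypothesis g_lip : lipschitz_gradient Lg g.
Hypothesis F_diff : forall y, differentiable F y.
Hypothesis F_lip : lipschitz_gradient LF F.

Variables (a b : R) (xp xc xn : 'rV[R]_m).
Hypothesis a_gt0 : 0 < a.
Hypothesis xn_min : argmin (inertial_objective f g F a b xp xc) xn.

Lemma argmin_fin_num : f xn \is a fin_num.
Proof.
have [fN [u fu]] := f_proper.
rewrite fin_numE fN /=; apply/eqP => fxn; have := xn_min u.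
rewrite /inertial_objective fxn mulry gtr0_sg// mul1e addey// leye_eq.
have := fN u; move: fu; case: (f u) => [r| |]//= _ _.
Qed.

Lemma argmin_le u r : f u = r%:E ->
  bregman F xn xc + a * dotp xn (grad g xc) + b * dotp xn (xp - xc)
    + a * fine (f xn) <=
  bregman F u xc + a * dotp u (grad g xc) + b * dotp u (xp - xc) + a * r.
Proof.
move=> fu; have := xn_min u.
rewrite /inertial_objective fu -(fineK argmin_fin_num).
by rewrite -!EFinM -!EFinD lee_fin.
Qed.

(** The first-order condition of the subproblem, solved for a subgradient of [f] at [xn], plus
    [grad g xn]. *)
Definition step_subgradient : 'rV[R]_m :=
  grad g xn - grad g xc + a^-1 *: (grad F xc - grad F xn)
  - (b / a) *: (xp - xc).

(** Minimality of [xn] against [u], divided by [a], bounds [f u] from below. Linearizing [F] at [xn]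
    costs [LF / (2 * a)] times the squared distance, and linearizing [g] there costs [Lg / 2] times
    it. *)
Lemma step_proximal (K : R) : LF / (2 * a) + Lg / 2 <= K ->
  proximal_subgradient K (fun y => f y + (g y)%:E)%E xn step_subgradient.
Proof.
move=> hK u.
have := f_proper.1 u; case fu: (f u) => [r| |]// _; last first.
  by rewrite addye// leey.
rewrite -(fineK argmin_fin_num) -!EFinD lee_fin.
have h1 := argmin_le fu.
have h2 := descent_lemma xn u F_diff F_lip.
have h3 := descent_lemma_ge xn u g_diff g_lip.
set e := enorm (u - xn) ^+ 2 in h2 h3 *.
have e0 : 0 <= e by exact: sqr_ge0.
have h4 := ler_wpM2r e0 hK.
rewrite -(ler_pM2l a_gt0).
have h5 := ler_wpM2l (ltW a_gt0) h4.
have h6 := ler_wpM2l (ltW a_gt0) h3.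
have E1 : a * ((LF / (2 * a) + Lg / 2) * e) = LF / 2 * e + a * (Lg / 2 * e).
  by field; rewrite gt_eqF.
have E2 : a * dotp step_subgradient (u - xn) =
    a * dotp (grad g xn) (u - xn) - a * dotp (u - xn) (grad g xc)
    + dotp (grad F xc) (u - xn) - dotp (grad F xn) (u - xn)
    - b * dotp (u - xn) (xp - xc).
  move: (u - xn) => w; rewrite /step_subgradient !(dotpC w).
  rewrite !dotpDl !dotpNl !dotpZl !dotpDl !dotpNl.
  have key (p1 p2 p3 p4 p5 p6 : R) : a * (p1 - p2 + a^-1 * (p3 - p4)
      - b / a * (p5 - p6)) = a * p1 - a * p2 + p3 - p4 - b * (p5 - p6).
    by field; rewrite gt_eqF.
  exact: key.
have E3 : bregman F u xc - bregman F xn xc =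
    F u - F xn - dotp (grad F xc) (u - xn).
  by rewrite /bregman !dotpBr; ring.
move: h1 h2 E2 E3 h5 h6; rewrite E1 !(dotpBl u xn).
generalize_reals; lra.
Qed.

Lemma step_subgradient_le : 0 <= b ->
  enorm step_subgradient <=
  (Lg + LF / a) * enorm (xn - xc) + b / a * enorm (xc - xp).
Proof.
move=> b0; rewrite /step_subgradient.
have h1 := enormD (grad g xn - grad g xc + a^-1 *: (grad F xc - grad F xn))
  (- ((b / a) *: (xp - xc))).
have h2 := enormD (grad g xn - grad g xc) (a^-1 *: (grad F xc - grad F xn)).
have h3 := g_lip xn xc.
have h4 := F_lip xc xn; rewrite (enormB xc) in h4.
have ai : 0 <= a^-1 by rewrite invr_ge0 ltW.
have h5 := ler_wpM2l ai h4.
rewrite enormN enormZ (ger0_norm (divr_ge0 b0 (ltW a_gt0))) (enormB xp) in h1.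
rewrite enormZ (ger0_norm ai) in h2.
apply: (le_trans h1); rewrite lerD2r; apply: (le_trans h2).
by rewrite mulrDl; apply: lerD => //; rewrite [leRHS]mulrAC [leRHS]mulrC.
Qed.

(** The minimizer is compared with [u = xc], where the Bregman distance vanishes, while strong
    convexity makes it at least [sigma / 2] times the squared step at [xn]. *)
Lemma step_decrease (alo ahi beta mu : R) :
  0 < sigma -> 0 < LF -> strongly_convex sigma F -> f xc \is a fin_num ->
  0 < alo -> 0 < mu -> alo <= a <= ahi -> 0 <= b <= beta ->
  fine (f xn) + g xn
    + ((sigma - ahi * Lg) / (2 * ahi) - mu * beta / (2 * alo))
      * enorm (xn - xc) ^+ 2 <=
  fine (f xc) + g xc + beta / (2 * mu * alo) * enorm (xc - xp) ^+ 2.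
Proof.
move=> s0 LF0 sF fxc alo0 mu0 /andP[alo_a a_ahi] /andP[b0 b_beta].
have h1 := argmin_le (esym (fineK fxc)).
have h2 := descent_lemma xc xn g_diff g_lip.
have h3 := strongly_convex_bregman xn xc s0 LF0 sF F_diff F_lip.
have h4 : bregman F xc xc = 0.
  by rewrite /bregman subrr sub0r dotpBr subrr oppr0.
set X := enorm (xn - xc) in h2 h3 *; set Y := enorm (xc - xp).
(* Young's inequality with weight [mu]: the first term weakens the decrease (it lowers [M1]), the
   second is the price of the previous step (it becomes [M2]). *)
have XY : - dotp (xn - xc) (xp - xc) <= mu * X ^+ 2 / 2 + Y ^+ 2 / (2 * mu).
  rewrite -dotpNr opprB; apply: (le_trans (dotp_le _ _)); rewrite -/X -/Y.
  rewrite -subr_ge0 [X in 0 <= X](_ : _ = (mu * X - Y) ^+ 2 / (2 * mu)).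
    by rewrite divr_ge0 ?sqr_ge0// mulr_ge0// ltW.
  by field; rewrite gt_eqF.
clearbody X Y; set Z := mu * X ^+ 2 / 2 + Y ^+ 2 / (2 * mu) in XY *.
have Z0 : 0 <= Z.
  have mu2 : 0 <= 2 * mu by rewrite mulr_ge0// ltW.
  by rewrite addr_ge0 ?divr_ge0 ?sqr_ge0 ?(mulr_ge0 (ltW mu0) (sqr_ge0 _)).
have bZ : - (b / a * dotp (xn - xc) (xp - xc)) <= beta / alo * Z.
  apply: (@le_trans _ _ (b / a * Z)).
    by rewrite -mulrN ler_wpM2l// divr_ge0// ltW.
  rewrite ler_wpM2r// ler_pM ?invr_ge0 ?(ltW a_gt0)// lef_pV2 ?posrE//.
have E : beta / alo * Z = mu * beta / (2 * alo) * X ^+ 2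
    + beta / (2 * mu * alo) * Y ^+ 2.
  by rewrite /Z; field; rewrite !gt_eqF.
have ahi0 : 0 < ahi by exact: lt_le_trans a_ahi.
have sa : (sigma - ahi * Lg) / (2 * ahi) * X ^+ 2 <=
    sigma / 2 / a * X ^+ 2 - Lg / 2 * X ^+ 2.
  rewrite -mulrBl ler_wpM2r ?sqr_ge0//.
  have -> : (sigma - ahi * Lg) / (2 * ahi) = sigma / 2 / ahi - Lg / 2.
    by field; rewrite gt_eqF.
  by rewrite lerD2r ler_wpM2l ?lef_pV2 ?posrE// divr_ge0// ltW.
have h5 : fine (f xn) + sigma / 2 / a * X ^+ 2 + dotp (xn - xc) (grad g xc)
    + b / a * dotp (xn - xc) (xp - xc) <= fine (f xc).
  rewrite -(ler_pM2l a_gt0).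
  have -> : a * (fine (f xn) + sigma / 2 / a * X ^+ 2
      + dotp (xn - xc) (grad g xc) + b / a * dotp (xn - xc) (xp - xc)) =
    a * fine (f xn) + sigma / 2 * X ^+ 2 + a * dotp (xn - xc) (grad g xc)
      + b * dotp (xn - xc) (xp - xc) by field; rewrite gt_eqF.
  move: h1 h3; rewrite h4 !(dotpBl xn xc).
  generalize_reals; lra.
move: h2 h5 bZ E sa; rewrite (dotpC (grad g xc)).
generalize_reals; lra.
Qed.

End AlgorithmStep.

(** * The Kurdyka-Lojasiewicz inequality *)

Section SlopeFamily.
Context {R : realType} {m : nat}.
Variable h : 'rV[R]_m -> \bar R.
Hypothesis h_lsc : lower_semicontinuous h.
Hypothesis h_nyN : forall x, h x != -oo%E.
Hypothesis h_semialg : semialg_fun h.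

Lemma graph_definable : definable (fun w : 'I_m + unit -> R =>
  h (\row_i w (inl i)) = (w (inr tt))%:E).
Proof.
have [k [eqs [ineqs hG]]] := h_semialg.
pose s (j : 'I_(m + 1)) :=
  match fintype.split j with inl i => inl i | inr _ => inr tt end.
have sl i : s (lshift 1 i) = inl i by rewrite /s (unsplitK (inl i)).
have sr i : s (rshift m i) = inr tt by rewrite /s (unsplitK (inr i)).
apply: (@definable_ext _ _ (fun w : 'I_m + unit -> R => exists i : 'I_k,
  all (fun p => mpoly.meval (fun j => w (s j)) p == 0) (eqs i) /\
  all (fun p => 0 < mpoly.meval (fun j => w (s j)) p) (ineqs i))).
  move=> w; have -> : (h (\row_i w (inl i)) = (w (inr tt))%:E) =
      graph h (\row_j w (s j)).
    rewrite /graph /= !mxE sr; congr (h _ = _).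
    by apply/rowP => i; rewrite !mxE sl.
  rewrite hG; split=> [[i hi]|[i _ hi]].
    by exists i => //; rewrite /basic_semialg_set /= row_fun.
  by exists i; rewrite /basic_semialg_set /= row_fun in hi.
apply: definable_exists_fin => i; apply: definable_and.
  apply: (@definable_all _ _ _ (eqs i) (fun p (w : 'I_m + unit -> R) =>
    mpoly.meval (fun j => w (s j)) p == 0)) => p.
  apply: (@definable_ext _ _ (fun w : 'I_m + unit -> R =>
    mpoly.meval (fun j => w (s j)) p = 0)); first by move=> w; split=> /eqP.
  by apply: definable_eq; [exact: polyfun_meval|exact: polyfun_cst].
apply: (@definable_all _ _ _ (ineqs i) (fun p (w : 'I_m + unit -> R) =>
    0 < mpoly.meval (fun j => w (s j)) p)) => p.
by apply: definable_lt; [exact: polyfun_cst|exact: polyfun_meval].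
Qed.

Variables (M K B : R).
Hypotheses (M_ge0 : 0 <= M) (K_gt0 : 0 < K) (B_ge0 : 0 <= B).

(* A point of [R^(3 m)] is a triple [(x, y, v)]. *)
Local Notation N := (m + m + m)%N.
Let ix (i : 'I_m) : 'I_N := lshift m (lshift m i).
Let iy (i : 'I_m) : 'I_N := lshift m (rshift m i).
Let iv (i : 'I_m) : 'I_N := rshift (m + m) i.

Let xof (w : 'I_N -> R) : 'rV[R]_m := \row_i w (ix i).
Let yof (w : 'I_N -> R) : 'rV[R]_m := \row_i w (iy i).
Let vof (w : 'I_N -> R) : 'rV[R]_m := \row_i w (iv i).

Definition triple (x y v : 'rV[R]_m) : 'rV[R]_N := row_mx (row_mx x y) v.

Lemma xof_triple x y v : xof (triple x y v 0) = x.
Proof. by apply/rowP => i; rewrite mxE !row_mxEl. Qed.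
Lemma yof_triple x y v : yof (triple x y v 0) = y.
Proof. by apply/rowP => i; rewrite mxE row_mxEl row_mxEr. Qed.
Lemma vof_triple x y v : vof (triple x y v 0) = v.
Proof. by apply/rowP => i; rewrite mxE row_mxEr. Qed.

Let level t w := t - M * dotp (xof w - yof w) (xof w - yof w).
Let minorant t w (u : 'rV[R]_m) :=
  level t w + dotp (vof w) (u - xof w) - K * dotp (u - xof w) (u - xof w).
Definition sqslope w :=
  dotp (vof w) (vof w) + dotp (xof w - yof w) (xof w - yof w).

(** Only [<=] is required between [h x] and its level, a closed condition for lower semicontinuous
    [h]; the minorant at [u = x] gives the reverse inequality. The minorant starts from [level t w]
    and not from [h x], hence is polynomial in [t], [w] and [u]. *)
Definition slope_family (t : R) : set 'rV[R]_N :=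
  [set z : 'rV[R]_N | let w := z 0 in
    [/\ forall i, `|w i| <= B, (h (xof w) <= (level t w)%:E)%E &
      forall u, ((minorant t w u)%:E <= h u)%E]].

Let polyfun_dotp (I : Type) (p q : (I -> R) -> 'rV[R]_m) :
  (forall i, polyfun (fun w => p w 0 i)) ->
  (forall i, polyfun (fun w => q w 0 i)) -> polyfun (fun w => dotp (p w) (q w)).
Proof. by move=> hp hq; apply: polyfun_sum => i; exact: polyfunM. Qed.

Let polyfun_row (I : Type) (s : 'I_m -> I) i :
  polyfun (fun w : I -> R => (\row_i w (s i) : 'rV[R]_m) 0 i).
Proof.
rewrite (_ : (fun w => _) = (fun w => w (s i))); first exact: polyfun_var.
by apply/funext => w; rewrite mxE.
Qed.

Let polyfun_subr (I : Type) (p q : (I -> R) -> 'rV[R]_m) i :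
  polyfun (fun w => p w 0 i) -> polyfun (fun w => q w 0 i) ->
  polyfun (fun w => (p w - q w) 0 i).
Proof.
move=> hp hq; rewrite (_ : (fun w => _) = (fun w => p w 0 i - q w 0 i)).
  exact: polyfunB.
by apply/funext => w; rewrite !mxE.
Qed.

Lemma sqslope_polyfun : polyfun sqslope.
Proof.
by apply: polyfunD; apply: polyfun_dotp => i;
  (exact: polyfun_row || by apply: polyfun_subr; exact: polyfun_row).
Qed.

Lemma sqslope_ge0 w : 0 <= sqslope w.
Proof. by rewrite addr_ge0// dotp_ge0. Qed.

Let polyfun_level (I : Type) (p : (I -> R) -> R) (s : 'I_N -> I) :
  polyfun p -> polyfun (fun w : I -> R => level (p w) (fun i => w (s i))).
Proof.
move=> hp; apply: polyfunB => //; apply: polyfunM; first exact: polyfun_cst.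
by apply: polyfun_dotp => i; apply: polyfun_subr; exact: polyfun_row.
Qed.

Let polyfun_minorant (I : Type) (p : (I -> R) -> R) (s : 'I_N -> I)
    (u : (I -> R) -> 'rV[R]_m) :
  polyfun p -> (forall i, polyfun (fun w => u w 0 i)) ->
  polyfun (fun w : I -> R => minorant (p w) (fun i => w (s i)) (u w)).
Proof.
move=> hp hu; apply: polyfunB; last first.
  apply: polyfunM; first exact: polyfun_cst.
  by apply: polyfun_dotp => i; apply: polyfun_subr => //; exact: polyfun_row.
apply: polyfunD; first exact: polyfun_level.
apply: polyfun_dotp => i; first exact: polyfun_row.
by apply: polyfun_subr => //; exact: polyfun_row.
Qed.

(** The values of [h] can enter a formula only through its graph: where [h u] is infinite the
    minorant condition is trivial, so quantifying over graph points loses nothing. *)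
Lemma slope_family_definable : definable_family slope_family.
Proof.
apply: (@definable_ext _ _ (fun w : unit + 'I_N -> R =>
  (forall i, i \in enum 'I_N -> - B <= w (inr i) /\ w (inr i) <= B) /\
  ((exists a, h (xof (w \o inr)) = a%:E /\ a = level (w (inl tt)) (w \o inr)) /\
   (forall y : 'I_m + unit -> R, h (\row_i y (inl i)) = (y (inr tt))%:E ->
     minorant (w (inl tt)) (w \o inr) (\row_i y (inl i)) <= y (inr tt))))).
  move=> w; rewrite /slope_family /= !row_fun.
  split=> [[hB [[a [ha aE]] hu]]|[hB hx hu]]; split.
  - move=> i; rewrite ler_norml.
    by have [] := hB i; rewrite ?mem_enum// => -> ->.
  - by rewrite [h _]ha aE.
  - move=> u; have := h_nyN u; case hE: (h u) => [r| |]// _; last exact: leey.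
    have := hu (fun k => match k with inl i => u 0 i | inr _ => r end).
    by rewrite /= row_eta lee_fin; apply.
  - move=> i _; have := hB i; rewrite ler_norml => /andP[] //.
  - split.
      exists (level (w (inl tt)) (w \o inr)); split=> //.
      apply/eqP; rewrite eq_le hx /=.
      have := hu (xof (w \o inr)); rewrite /minorant subrr.
      have d0 (u : 'rV[R]_m) : dotp u 0 = 0.
        by rewrite /dotp big1// => i _; rewrite mxE mulr0.
      by rewrite !d0 mulr0 subr0 addr0.
    by move=> y hy; have := hu (\row_i y (inl i)); rewrite hy lee_fin.
apply: definable_and.
  apply: (@definable_all_seq _ _ _ (enum 'I_N) (fun i (w : unit + 'I_N -> R) =>
    - B <= w (inr i) /\ w (inr i) <= B)) => i.
  by apply: definable_and; apply: definable_le;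
    (exact: polyfun_var || exact: polyfun_cst).
apply: definable_and.
  apply: (definable_existsR (A := fun (w : unit + 'I_N -> R) a =>
    h (xof (w \o inr)) = a%:E /\ a = level (w (inl tt)) (w \o inr))) => /=.
  apply: definable_and.
    exact: (definable_reindex (fun k : 'I_m + unit =>
      match k with inl i => inl (inr (ix i)) | inr _ => inr tt end)
      graph_definable).
  apply: definable_eq; first exact: polyfun_var.
  exact: (polyfun_level (inl \o inr)
    (polyfun_var (I := (unit + 'I_N) + unit) (inl (inl tt)))).
apply: (definable_forall (A := fun (w : unit + 'I_N -> R)
    (y : 'I_m + unit -> R) =>
  h (\row_i y (inl i)) = (y (inr tt))%:E ->
  minorant (w (inl tt)) (w \o inr) (\row_i y (inl i)) <= y (inr tt))) => /=.
apply: definable_imp.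
  exact: (definable_reindex inr graph_definable).
apply: definable_le; last exact: polyfun_var.
apply: (polyfun_minorant (inl \o inr)
  (polyfun_var (I := (unit + 'I_N) + ('I_m + unit)) (inl (inl tt)))) => i.
exact: (polyfun_row (inr \o inl)).
Qed.

Lemma closed_sublevel (T : topologicalType) (p : T -> 'rV[R]_m) (l : T -> R) :
  continuous p -> continuous l -> closed [set z | (h (p z) <= (l z)%:E)%E].
Proof.
move=> cp cl; rewrite -[X in closed X]setCK; apply: open_closedC.
rewrite (_ : ~` _ = \bigcup_(c in [set: R])
  ((l @^-1` [set x | x < c]) `&` (p @^-1` [set x | (c%:E < h x)%E]))).
  apply: bigcup_open => c _; apply: openI.
    by apply: open_comp => [z _|]; [exact: cl|exact: open_lt].
  apply: open_comp => [z _|]; first exact: cp.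
  by have /lower_semicontinuousP := h_lsc; exact.
apply/seteqP; split=> z /=.
  move=> /negP; rewrite -ltNge; case hE: (h (p z)) => [r| |]//.
    rewrite lte_fin => lr; exists ((l z + r) / 2) => //.
    split=> /=; rewrite ?hE ?lte_fin; lra.
  by move=> _; exists (l z + 1) => //; split; rewrite /= ?hE ?ltry// ltrDl.
move=> [c _ [/= lc ch]]; apply/negP; rewrite -ltNge.
by apply: lt_trans ch; rewrite lte_fin.
Qed.

Let xof_continuous : continuous (fun z : 'rV[R]_N => xof (z 0)).
Proof.
move=> z; apply/(@cvgrPdist_lt R 'rV[R]_m 'rV[R]_N (nbhs z) _) => e e0.
apply: filterS (nbhsx_ballx z e e0) => z'; rewrite -ball_normE /=.
apply: le_lt_trans; rewrite [leLHS]/Num.norm /= mx_normrE.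
apply/bigmax_leP; split=> // -[i j] _ /=.
rewrite !mxE [leRHS]/Num.norm /= mx_normrE.
by apply/bigmax_geP; right; exists (0, ix j) => //=; rewrite !mxE.
Qed.

Lemma slope_family_compact t : compact (slope_family t).
Proof.
apply: bounded_closed_compact.
  exists B; split; first exact: num_real.
  move=> c Bc z [hB _ _] /=; rewrite [leLHS]/Num.norm /= mx_normrE.
  apply/bigmax_leP; split=> [|[a j] _ /=]; first exact: le_trans (ltW Bc).
  by rewrite ord1 (le_trans (hB j))// ltW.
rewrite (_ : slope_family t = (\bigcap_(i in [set: 'I_N])
    (fun z : 'rV[R]_N => `|z 0 i|) @^-1` [set x | x <= B]) `&`
  ([set z : 'rV[R]_N | (h (xof (z 0%R)) <= (level t (z 0%R))%:E)%E] `&`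
   \bigcap_(u in [set: 'rV[R]_m])
     [set z : 'rV[R]_N | ((minorant t (z 0%R) u)%:E <= h u)%E])); last first.
  apply/seteqP; split=> z /=.
    by move=> [hB hx hu]; split=> [i _|]; [exact: hB|split=> // u _; exact: hu].
  by move=> [hB [hx hu]]; split=> // [i|u]; [exact: (hB i)|exact: (hu u)].
apply: closedI; [|apply: closedI].
- apply: closed_bigI => i _; apply: preimage_closed; last exact: closed_le.
  move=> z _; apply: (@continuous_comp 'rV[R]_N R R (fun z => z 0 i)).
    exact: coord_continuous.
  exact: norm_continuous.
- apply: closed_sublevel; first exact: xof_continuous.
  exact: (polyfun_continuous (polyfun_level (fun i => i) (polyfun_cst t))).
- apply: closed_bigI => u _; have := h_nyN u; case: (h u) => [r| |]// _.
    rewrite (_ : [set _ | _] = (fun z : 'rV[R]_N => minorant t (z 0) u) @^-1`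
        [set x | x <= r]); last first.
      by apply/seteqP; split=> z /=; rewrite lee_fin.
    apply: preimage_closed; last exact: closed_le.
    move=> z _; apply: (polyfun_continuous (p := fun w => minorant t w u)).
    apply: (polyfun_minorant (fun i => i) (polyfun_cst t)) => i.
    exact: polyfun_cst.
  rewrite (_ : [set _ | _] = setT); first exact: closedT.
  by apply/seteqP; split=> z //= _; exact: leey.
Qed.

(** The minorant of [z] is tested at the point [x'] of [z'], where [h] is at most the level of [z'].
    A slope bound is thus needed at the upper level only. *)
Lemma slope_family_slope s t z z' rho : s < t -> slope_family t z ->
  slope_family s z' -> 0 < rho -> sqslope (z 0) <= rho ^+ 2 ->
  t - s <= (2 * M + 1) * rho * (\sum_i `|z 0 i - z' 0 i|)
           + K * (\sum_i `|z 0 i - z' 0 i|) ^+ 2.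
Proof.
move=> st [_ _ /(_ (xof (z' 0))) hz] [_ hz' _] rho0.
have := le_trans hz hz'; rewrite lee_fin /minorant /level /sqslope.
set x := xof (z 0); set y := yof (z 0); set v := vof (z 0).
set x' := xof (z' 0); set y' := yof (z' 0) => ineq.
rewrite -!sqr_enorm => slope.
set D := \sum_i _.
have DE : D = \sum_i `|(x - x') 0 i| + \sum_i `|(y - y') 0 i|
    + \sum_i `|z 0 (iv i) - z' 0 (iv i)|.
  rewrite /D big_split_ord /= big_split_ord /=; congr (_ + _ + _);
    by apply: eq_bigr => i _; rewrite !mxE.
have xD : enorm (x - x') <= D.
  rewrite DE -addrA; apply: (le_trans (enorm_le_sum _)).
  by rewrite lerDl addr_ge0// sumr_ge0.
have pD : enorm ((x - y) - (x' - y')) <= D.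
  rewrite (_ : (x - y) - (x' - y') = (x - x') - (y - y')); last first.
    by rewrite !opprB addrACA [- y + _]addrC -addrACA.
  apply: (le_trans (enormD _ _)); rewrite enormN DE.
  by rewrite -[leLHS]addr0 lerD ?sumr_ge0// lerD// enorm_le_sum.
set p := x - y in ineq slope pD; set p' := x' - y' in ineq pD.
clearbody D p p'; have D0 : 0 <= D := le_trans (enorm_ge0 _) xD.
have v_rho : enorm v <= rho.
  rewrite -(ler_pXn2r (ltn0Sn 1)) ?nnegrE ?enorm_ge0 ?(ltW rho0)//.
  by apply: le_trans slope; rewrite lerDl sqr_ge0.
have p_rho : enorm p <= rho.
  rewrite -(ler_pXn2r (ltn0Sn 1)) ?nnegrE ?enorm_ge0 ?(ltW rho0)//.
  by apply: le_trans slope; rewrite lerDr sqr_ge0.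
have h1 : dotp v (x - x') <= rho * D.
  by apply: (le_trans (dotp_le _ _)); rewrite ler_pM ?enorm_ge0.
(* Convexity of the squared norm at [p]; multiplied by [M] and added to [h1], it gives the factor
   [2 * M + 1]. *)
have h2 : dotp p p - dotp p' p' <= 2 * (rho * D).
  apply: (@le_trans _ _ (2 * dotp p (p - p'))).
    have := dotp_ge0 (p - p'); rewrite !dotpE (dotpC p' p); lra.
  rewrite ler_wpM2l//; apply: (le_trans (dotp_le _ _)).
  by rewrite ler_pM ?enorm_ge0.
have h3 : dotp (x' - x) (x' - x) <= D ^+ 2.
  by rewrite -sqr_enorm enormB ler_pXn2r ?nnegrE ?enorm_ge0.
have h4 := ler_wpM2l M_ge0 h2.
have h5 := ler_wpM2l (ltW K_gt0) h3.
have h6 : dotp v (x - x') = - dotp v (x' - x) by rewrite -dotpNr opprB.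
move: ineq h1 h4 h5; rewrite h6; generalize_reals; lra.
Qed.

Lemma slope_family_mem t x y v : t = fine (h x) + M * dotp (x - y) (x - y) ->
  h x \is a fin_num -> proximal_subgradient K h x v ->
  enorm x <= B -> enorm y <= B -> enorm v <= B ->
  slope_family t (triple x y v).
Proof.
move=> tE hx hv xB yB vB.
have lE : level t (triple x y v 0) = fine (h x).
  by rewrite /level xof_triple yof_triple tE addrK.
split.
- move=> i; rewrite -[i]splitK; case: (fintype.split i) => [k|k] /=.
    rewrite row_mxEl -[k]splitK; case: (fintype.split k) => [l|l] /=.
      by rewrite row_mxEl (le_trans (coord_le_enorm _ _)).
    by rewrite row_mxEr (le_trans (coord_le_enorm _ _)).
  by rewrite row_mxEr (le_trans (coord_le_enorm _ _)).
- by rewrite lE xof_triple fineK.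
- move=> u; apply: le_trans (hv u).
  rewrite /minorant lE xof_triple vof_triple -sqr_enorm.
  by rewrite -{2}(fineK hx) -EFinD lee_fin addrA.
Qed.

(** The Kurdyka-Lojasiewicz inequality in integrated form. A free positive [rho] above the slope
    stands for the slope itself, which may be zero. *)
Lemma kl_inequality (a : R) :
  exists b (Phi : R -> R) P C, [/\ a < b, 0 < C,
    forall t, a < t < b -> 0 <= Phi t <= P &
    forall s t x y v rho, a < s -> s < t -> t < b ->
      t = fine (h x) + M * dotp (x - y) (x - y) ->
      h x \is a fin_num -> proximal_subgradient K h x v ->
      enorm x <= B -> enorm y <= B -> enorm v <= B ->
      0 < rho -> enorm v ^+ 2 + enorm (x - y) ^+ 2 <= rho ^+ 2 ->
      t - s <= C * rho * (Phi t - Phi s)].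
Proof.
have C0 : 0 < 2 * M + 1 by rewrite ltr_wpDl// mulr_ge0.
have [b [Phi [P [C [ab C_gt0 PhiP key]]]]] := desingularization a C0 K_gt0
  slope_family_definable slope_family_compact
  (fun t z i (Az : slope_family t z) => let: And3 hB _ _ := Az in hB i)
  sqslope_polyfun sqslope_ge0 slope_family_slope.
exists b, Phi, P, C.
split=> // s t x y v rho as_ st tb tE hx hv xB yB vB rho0 q.
apply: (key s t _ rho as_ st tb (slope_family_mem tE hx hv xB yB vB) rho0).
by rewrite /sqslope xof_triple yof_triple vof_triple -!sqr_enorm.
Qed.

End SlopeFamily.

(** * Finite length and critical limits *)

Section ProximalLimits.
Context {R : realType} {m : nat}.
Implicit Types (h : 'rV[R]_m -> \bar R) (x v : 'rV[R]_m).

Lemma proximal_frechet (K : R) h x v : 0 < K -> h x \is a fin_num ->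
  (forall y, h y != -oo%E) ->
  proximal_subgradient K h x v -> frechet_subdiff h x v.
Proof.
move=> K0 hx hN hv; split; first by rewrite ltey_eq hx.
rewrite limf_einfE; apply/lee_addgt0Pr => e e0.
rewrite -leeBlDr// sub0e; pose V := [set y | y != x /\ K * enorm (y - x) <= e].
apply: (@le_trans _ _ (ereal_inf
  [set ((h y - h x - (dotp v (y - x))%:E) / (enorm (y - x))%:E)%E | y in V])).
  apply: le_ereal_inf_tmp => _ [y [yx Ky] <-].
  have n0 : 0 < enorm (y - x).
    rewrite lt_neqAle enorm_ge0 andbT eq_sym; apply/eqP => /enorm_eq0/eqP.
    by rewrite subr_eq0 (negbTE yx).
  have := hv y; have := hN y; rewrite -(fineK hx).
  case: (h y) => [r| |]// _; last first.
    by move=> _; rewrite inver gt_eqF// gt0_mulye ?leey// lte_fin invr_gt0.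
  rewrite -!EFinD lee_fin inver gt_eqF// -EFinM lee_fin ler_pdivlMr//.
  have := ler_wpM2r (ltW n0) Ky; rewrite expr2; lra.
apply: ereal_sup_ubound; exists V => //.
rewrite /dnbhs /within /=.
(* Neighbourhoods are balls of the sup norm, and [enorm] is at most [m] times that norm; the [+ 1]
   keeps the constant positive for [m = 0]. *)
have k0 : 0 < K * (m%:R + 1) by rewrite mulr_gt0// ltr_wpDl.
apply: filterS (nbhsx_ballx x _ (divr_gt0 e0 k0)) => y + yx.
rewrite -ball_normE /= distrC => yxe; split=> //.
apply: (@le_trans _ _ (K * ((m%:R + 1) * `|y - x|))).
  rewrite ler_wpM2l ?(ltW K0)//; apply: (le_trans (enorm_le_norm _)).
  by rewrite ler_wpM2r// lerDl.
by rewrite mulrA -ler_pdivlMl// mulrC ltW.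
Qed.

(** The geometric mean of [s] and [q] is at most [s / 4 + q]. As each step is charged to the next
    two with weight 1/4, half of the length is absorbed and the rest telescopes in [p]. *)
Lemma bounded_length (d p : nat -> R) (C : R) (n0 : nat) :
  (forall n, 0 <= d n) -> 0 < C -> (forall n, (n0 <= n)%N -> 0 <= p n) ->
  (forall n rho, (n0 <= n)%N -> 0 < rho -> d n + d n.+1 <= rho ->
     d n.+2 ^+ 2 <= C * rho * (p n - p n.+1)) ->
  exists L, forall N, \sum_(k < N) d k <= L.
Proof.
move=> d0 C0 p0 hd.
have step n : (n0 <= n)%N ->
    d n.+2 <= (d n + d n.+1) / 4 + C * (p n - p n.+1).
  move=> nn; set q := C * _; set s := d n + d n.+1.
  have s0 : 0 <= s by rewrite addr_ge0.
  have hq rho : 0 < rho -> s <= rho -> d n.+2 ^+ 2 <= rho * q.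
    by move=> r0 sr; rewrite /q mulrA (mulrC rho); exact: hd.
  have q0 : 0 <= q.
    rewrite -(pmulr_rge0 _ (_ : 0 < s + 1)) ?ltr_wpDl//.
    by apply: le_trans (hq _ _ _); rewrite ?sqr_ge0 ?ltr_wpDl ?lerDl.
  apply/ler_addgt0Pr => e e0.
  (* The slack keeps [rho] positive when [s = 0] and costs exactly [e] after division by 4. *)
  have := hq (s + 4 * e) _ _.
  rewrite ltr_wpDl ?mulr_gt0// lerDl ltW ?mulr_gt0//.
  move=> /(_ isT isT) h; have w0 : 0 <= s / 4 + q + e.
    by rewrite !addr_ge0 ?divr_ge0 ?(ltW e0).
  rewrite -(ler_pXn2r (ltn0Sn 1)) ?nnegrE//; apply: (le_trans h).
  have := sqr_ge0 ((s + 4 * e) / 4 - q); nra.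
(* The two boundary terms are chosen so that [W n.+1 <= W n] is precisely [step n]. *)
pose W n := (\sum_(k < n.+2) d k) / 2 + d n.+1 / 2 + d n / 4 + C * p n.
have Wn n : (n0 <= n)%N -> W n <= W n0.
  elim: n => [|n ih]; first by rewrite leqn0 => /eqP ->.
  rewrite leq_eqVlt => /predU1P[->//|]; rewrite ltnS => nn.
  apply: le_trans (ih nn); have := step n nn.
  rewrite /W [X in X / 2 + _ + _ + _ <= _]big_ord_recr /=; lra.
exists (2 * W n0) => N; pose k := (N + n0)%N.
have : W k <= W n0 by apply: Wn; rewrite leq_addl.
have : \sum_(i < N) d i <= \sum_(i < k.+2) d i.
  have Nk : (N <= k.+2)%N by rewrite /k -addn2 -addnA leq_addr.
  rewrite -!(big_mkord xpredT) [leRHS](big_cat_nat (n := N))//= lerDl.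
  by rewrite sumr_ge0.
move=> SN; rewrite /W.
have := d0 k; have := d0 k.+1.
have : 0 <= C * p k by rewrite mulr_ge0 ?p0 ?leq_addl// ltW.
lra.
Qed.


Lemma finite_length_cvg (x : nat -> 'rV[R]_m) (L : R) :
  (forall N, \sum_(k < N) enorm (x k.+1 - x k) <= L) ->
  (\sum_(0 <= n <oo) (enorm (x n.+1 - x n))%:E < +oo)%E /\ cvgn x.
Proof.
move=> hL; split.
  apply: (@le_lt_trans _ _ L%:E); last exact: ltry.
  apply: lime_le.
    by apply: is_cvg_nneseries => n _ _; rewrite lee_fin enorm_ge0.
  by apply: nearW => N; rewrite sumEFin lee_fin big_mkord.
have cs : cvgn (series (telescope x)).
  have : cvgn [normed series (telescope x)].
    apply: nondecreasing_is_cvgn.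
      by apply: nondecreasing_series => *; exact: normr_ge0.
    exists L => _ [N _ <-]; apply: le_trans (hL N).
    rewrite /normed_series_of /series /= big_mkord; apply: ler_sum => k _.
    exact: norm_le_enorm.
  move=> /cauchy_cvgP/cauchy_seriesP ncvg.
  apply/cauchy_cvgP/cauchy_seriesP => e /ncvg.
  apply: filterS => n /=; rewrite ger0_norm ?sumr_ge0//.
  by apply: le_lt_trans; apply: ler_norm_sum.
rewrite (_ : x = fun n => x 0%N + series (telescope x) n).
  by apply: is_cvgD; [exact: is_cvg_cst|exact: cs].
by apply/funext => n; exact: eq_sum_telescope.
Qed.

(** Convergence of the values is the delicate point. Lower semicontinuity bounds the limit from
    below and, with the bound [T], makes [h z] finite; the upper bound comes from testing the
    proximal inequality at [x n] in the point [z]. *)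
Lemma limit_critical (K T : R) h (x v : nat -> 'rV[R]_m) z : 0 < K ->
  lower_semicontinuous h -> (forall y, h y != -oo%E) ->
  (forall n, h (x n) \is a fin_num) -> (forall n, fine (h (x n)) <= T) ->
  (forall n, proximal_subgradient K h (x n) (v n)) ->
  x n @[n --> \oo] --> z -> enorm (v n) @[n --> \oo] --> 0 ->
  crit h z.
Proof.
move=> K0 lsc hN hfin hT hv xz v0.
have hz : h z \is a fin_num.
  rewrite fin_numE hN /=; apply/eqP => hzy.
  have [|V zV hV] := lsc z T; first by rewrite hzy ltry.
  have [n _ /(_ n (leqnn n))/hV] := xz _ zV.
  by rewrite -(fineK (hfin n)) lte_fin ltNge hT.
have e0 : enorm (z - x n) @[n --> \oo] --> (0 : R).
  apply: (@squeeze_cvgr _ _ _ _ (fun=> 0) (fun n => m%:R * `|z - x n|)).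
  - by apply: nearW => n; rewrite enorm_ge0 enorm_le_norm.
  - exact: cvg_cst.
  rewrite -[X in _ --> X](mulr0 m%:R); apply: cvgMr.
  rewrite -(@normr0 _ 'rV[R]_m) -(subrr z).
  by apply: cvg_norm; apply: cvgB => //; exact: cvg_cst.
have hx_cvg : fine (h (x n)) @[n --> \oo] --> fine (h z).
  apply/cvgrPdist_le => e ep; near=> n.
  have lower : fine (h z) - e < fine (h (x n)).
    rewrite -lte_fin fineK//; near: n.
    have [V zV hV] : exists2 V, nbhs z V &
        forall y, V y -> ((fine (h z) - e)%:E < h y)%E.
      by apply: lsc; rewrite -{2}(fineK hz) lte_fin ltrBlDr ltrDl.
    by have [N _ hN'] := xz _ zV; exists N => // k /hN'/hV.
  have upper : fine (h (x n)) <= fine (h z) + e.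
    have : fine (h (x n)) + (dotp (v n) (z - x n) - K * enorm (z - x n) ^+ 2)
        <= fine (h z).
      by rewrite -lee_fin EFinD !fineK//; exact: hv.
    have e1 : enorm (z - x n) <= 1.
      by near: n; exact: (cvgr_le _ e0 _ ltr01).
    have e2 : enorm (z - x n) <= e / (K + 1).
      near: n; apply: (cvgr_le _ e0); by rewrite divr_gt0// addr_gt0.
    have v1 : enorm (v n) <= 1 by near: n; exact: (cvgr_le _ v0 _ ltr01).
    have hd : - dotp (v n) (z - x n) <= enorm (z - x n).
      rewrite -dotpNr; apply: (le_trans (dotp_le _ _)); rewrite enormN.
      by rewrite ler_piMl ?enorm_ge0.
    have hK : K * enorm (z - x n) ^+ 2 <= K * enorm (z - x n).
      by rewrite ler_wpM2l ?(ltW K0)// expr2 ler_piMl ?enorm_ge0.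
    move: e2; rewrite ler_pdivlMr ?addr_gt0//; move: hd hK.
    generalize_reals; lra.
  by rewrite ler_norml; apply/andP; split; lra.
split; first by rewrite ltey_eq hz.
exists x, v; split=> //.
- rewrite -(fineK hz); apply: cvg_EFin => //; exact: nearW.
- by move=> n; exact: (proximal_frechet K0).
- apply/cvgrPdist_le => e ep; near=> n.
  rewrite sub0r normrN; apply: (le_trans (norm_le_enorm _)).
  by near: n; exact: (cvgr_le _ v0 _ ep).
Unshelve. all: by end_near. Qed.

End ProximalLimits.

Section Convergence.
#[local] Opaque grad dotp enorm.
Context {R : realType} {m : nat}.
Variables (h : 'rV[R]_m -> \bar R) (x v : nat -> 'rV[R]_m).
Variables (K M c C1 B lb : R).
Let d n := enorm (x n.+1 - x n).
Hypotheses (h_lsc : lower_semicontinuous h) (h_nyN : forall y, h y != -oo%E).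
Hypothesis h_semialg : semialg_fun h.
Hypotheses (K_gt0 : 0 < K) (M_ge0 : 0 <= M) (c_gt0 : 0 < c) (C1_ge0 : 0 <= C1).
Hypothesis h_fin : forall k, h (x k.+2) \is a fin_num.
Hypothesis v_subgrad : forall k, proximal_subgradient K h (x k.+2) (v k).
Hypothesis v_le : forall k, enorm (v k) <= C1 * (d k.+1 + d k).
Hypothesis h_decrease : forall k,
  fine (h (x k.+3)) + (M + c) * d k.+2 ^+ 2 <=
  fine (h (x k.+2)) + M * d k.+1 ^+ 2.
Hypothesis x_bounded : forall n, enorm (x n) <= B.
Hypothesis h_lbound : forall k, lb <= fine (h (x k.+2)).

(** The hypotheses on [h] begin at index 2 because [x 0] and [x 1] are free starting points, where
    [h] may be infinite. *)
Lemma kl_convergence : (\sum_(0 <= n <oo) (enorm (x n.+1 - x n))%:E < +oo)%E /\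
  exists2 z, crit h z & x n @[n --> \oo] --> z.
Proof.
pose H k := fine (h (x k.+2)) + M * d k.+1 ^+ 2.
have d_ge0 n : 0 <= d n by exact: enorm_ge0.
have H_dec k : H k.+1 + c * d k.+2 ^+ 2 <= H k.
  by have := h_decrease k; rewrite /H mulrDl addrA.
have H_decS k : H k.+1 <= H k.
  by apply: le_trans (H_dec k); rewrite lerDl mulr_ge0 ?sqr_ge0// ltW.
have H_mono n k : (n <= k)%N -> H k <= H n.
  elim: k => [|k ih]; first by rewrite leqn0 => /eqP ->.
  rewrite leq_eqVlt => /predU1P[->//|]; rewrite ltnS => /ih.
  exact: le_trans (H_decS k).
have infH : has_inf (range H).
  split; first by exists (H 0%N), 0%N.
  exists lb => _ [k _ <-]; rewrite (le_trans (h_lbound k))// lerDl.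
  by rewrite mulr_ge0 ?sqr_ge0.
set a := inf (range H).
have aH k : a <= H k by apply: ge_inf; [exact: infH.2|exists k].
have [L hL] : exists L, forall N, \sum_(k < N) d k <= L.
  (* If the infimum is attained, [H] is constant from there on, [H_dec] makes the later steps zero,
     and [p = 0] will do. Otherwise every [H k] lies strictly above [a], as [key] requires. *)
  have [[n Hn]|H_neq] := pselect (exists n, H n = a).
    apply: (@bounded_length _ d (fun=> 0) 1 n) => // k rho nk rho0 _.
    have Ha j : (n <= j)%N -> H j = a.
      by move=> nj; apply/eqP; rewrite eq_le aH -Hn H_mono.
    have := H_dec k; rewrite !Ha// ?(leqW nk)// gerDl pmulr_rle0//.
    by rewrite subrr mulr0.
  have B_ge0 : 0 <= B by exact: le_trans (enorm_ge0 _) (x_bounded 0%N).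
  have dB n : d n <= 2 * B.
    apply: (le_trans (enormD _ _)); rewrite enormN.
    have := x_bounded n; have := x_bounded n.+1; lra.
  (* The ball must also contain the subgradients; two successive steps add up to at most [4 * B]. *)
  pose B' := B + C1 * (4 * B).
  have C4B : 0 <= C1 * (4 * B) by rewrite mulr_ge0// mulr_ge0// ler0n.
  have B'_ge0 : 0 <= B' by rewrite addr_ge0.
  have xB' n : enorm (x n) <= B'.
    by rewrite (le_trans (x_bounded n))// lerDl.
  have vB' n : enorm (v n) <= B'.
    apply: (le_trans (v_le n)); rewrite ler_wpDl// ler_wpM2l//.
    have := dB n; have := dB n.+1; lra.
  have [b [Phi [P [C [ab C0 PhiP key]]]]] :=
    kl_inequality h_lsc h_nyN h_semialg M_ge0 K_gt0 B'_ge0 a.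
  have aH' k : a < H k.
    by rewrite lt_neqAle aH andbT eq_sym; apply/eqP => Hk; apply: H_neq;
      exists k.
  have [n0 Hb] : exists n0, H n0 < b.
    have ba : 0 < b - a by rewrite subr_gt0.
    have [_ [n0 _ <-]] := inf_adherent ba infH.
    by rewrite -/a addrC subrK => Hb; exists n0.
  have {}Hb k : (n0 <= k)%N -> a < H k < b.
    by move=> nk; rewrite aH' (le_lt_trans (H_mono _ _ nk)).
  apply: (@bounded_length _ d (Phi \o H) (C * (C1 + 1) / c) n0) => //.
  - by rewrite divr_gt0// mulr_gt0// ltr_wpDl.
  - by move=> n /Hb/PhiP/andP[].
  move=> k rho nk rho0 d_rho /=.
  rewrite -(ler_pM2l c_gt0).
  have -> : c * (C * (C1 + 1) / c * rho * (Phi (H k) - Phi (H k.+1))) =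
      C * ((C1 + 1) * rho) * (Phi (H k) - Phi (H k.+1)).
    by field; rewrite gt_eqF.
  (* The two parts of the slope are at most [C1 * rho] and [rho], so the sum of their squares is at
     most the square of [(C1 + 1) * rho]. *)
  have rho'0 : 0 < (C1 + 1) * rho by rewrite mulr_gt0// ltr_wpDl.
  have := H_dec k; have := H_decS k; rewrite le_eqVlt => /predU1P[HE|Hlt].
    by rewrite HE gerDl subrr mulr0.
  rewrite addrC -lerBrDr => /le_trans; apply.
  have /andP[_ Hkb] := Hb k nk.
  apply: (key _ _ (x k.+2) (x k.+1) (v k)) => //.
    by rewrite -sqr_enorm.
  have v_rho : enorm (v k) <= C1 * rho.
    by apply: (le_trans (v_le k)); rewrite ler_wpM2l// addrC.
  have dk_rho : d k.+1 <= rho by apply: le_trans d_rho; rewrite lerDr.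
  rewrite -/(d k.+1); apply: (@le_trans _ _ ((C1 * rho) ^+ 2 + rho ^+ 2)).
    have rho_ge0 := ltW rho0; have C1rho := mulr_ge0 C1_ge0 rho_ge0.
    by apply: lerD; rewrite ler_pXn2r ?nnegrE ?enorm_ge0 ?d_ge0.
  rewrite -subr_ge0 [X in 0 <= X](_ : _ = 2 * C1 * rho ^+ 2); last by ring.
  by rewrite mulr_ge0 ?sqr_ge0// mulr_ge0.
have [sum_fin x_cvg] := finite_length_cvg hL.
split=> //; exists (limn x) => //.
have d0 : d n @[n --> \oo] --> (0 : R).
  apply: cvg_series_cvg_0; apply: nondecreasing_is_cvgn.
    by apply: nondecreasing_series => *.
  by exists L => _ [N _ <-]; rewrite /series /= big_mkord.
have shift (u : nat -> R) (l : R) k : u n @[n --> \oo] --> l ->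
  u (n + k)%N @[n --> \oo] --> l by move=> ul; rewrite cvg_shiftn.
apply: (@limit_critical _ _ K (H 0%N) h (fun k => x k.+2) v) => //.
- move=> n; apply: le_trans (H_mono 0%N n (leq0n n)).
  by rewrite lerDl mulr_ge0 ?sqr_ge0.
- rewrite (_ : (fun k => x k.+2) = (fun k => x (k + 2)%N)).
    by rewrite cvg_shiftn.
  by apply/funext => k; rewrite addn2.
apply: (@squeeze_cvgr _ _ _ _ (fun=> 0) (fun n => C1 * (d n.+1 + d n))).
- by apply: nearW => n; rewrite enorm_ge0 v_le.
- exact: cvg_cst.
rewrite -[X in _ --> X](mulr0 C1); apply: cvgMr.
rewrite -[X in _ --> X](addr0 0); apply: cvgD => //.
by have := shift d 0 1%N d0; under eq_fun do rewrite addn1.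
Qed.

End Convergence.

(** * Application to the sequence generated by the algorithm *)

Lemma lower_semicontinuousD_real (R : realType) (T : topologicalType)
    (f : T -> \bar R) (g : T -> R) : lower_semicontinuous f -> continuous g ->
  lower_semicontinuous (fun y => f y + (g y)%:E)%E.
Proof.
move=> lf cg x a afg.
have [b [e [e0 bf ab]]] : exists b e,
    [/\ 0 < e, (b%:E < f x)%E & a <= b + g x - e].
  move: afg; case: (f x) => [r| |]//.
    rewrite -EFinD lte_fin => ar; pose e := (r + g x - a) / 2.
    exists (r - e), e; rewrite lte_fin /e; split; lra.
  by move=> _; exists (a - g x + 1), 1; split=> //; [rewrite ltry|lra].
have [V xV hV] := lf x b bf.
exists (V `&` [set y | `|g x - g y| < e]).
  by apply: filterI => //; have /cvgrPdist_lt /(_ e e0) := cg x.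
move=> y [/hV bfy /= gxy].
have gy : g x - e < g y by move: gxy; rewrite ltr_norml => /andP[]; lra.
apply: (@lt_trans _ _ (b%:E + (g y)%:E)%E); last by rewrite lteD2rE.
by rewrite -EFinD lte_fin; lra.
Qed.

Theorem corollary13 (R : realType) (m : nat) (hm : (1 <= m)%N)
    (f : 'rV[R]_m -> \bar R) (g F : 'rV[R]_m -> R) (sigma Lg LF : R)
    (f_proper : proper_fun f) (f_lsc : lower_semicontinuous f)
    (f_bounded_below : bounded_below f)
    (g_diff : forall y, differentiable g y)
    (Lg_ge0 : 0 <= Lg) (g_lip : lipschitz_gradient Lg g)
    (sigma_gt0 : 0 < sigma) (F_sconvex : strongly_convex sigma F)
    (F_diff : forall y, differentiable F y)
    (LF_gt0 : 0 < LF) (F_lip : lipschitz_gradient LF F)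
    (mu alpha_lo alpha_hi beta : R)
    (mu_gt0 : 0 < mu) (alpha_lo_gt0 : 0 < alpha_lo) (beta_ge0 : 0 <= beta)
    (h_mu : beta * (mu ^+ 2 + 1) < mu * (sigma - Lg * alpha_lo))
    (h_alpha : alpha_lo < alpha_hi)
    (h_M : let M1 := (sigma - alpha_hi * Lg) / (2 * alpha_hi)
                     - mu * beta / (2 * alpha_lo) in
           let M2 := beta / (2 * mu * alpha_lo) in
           M2 < M1)
    (fg_coercive : coercive (fun y => (f y + (g y)%:E)%E))
    (fg_semialg : semialg_fun (fun y => (f y + (g y)%:E)%E))
    (alpha_ beta_ : nat -> R)
    (alpha_bounds : forall n, (1 <= n)%N -> alpha_lo <= alpha_ n <= alpha_hi)
    (beta_bounds : forall n, (1 <= n)%N -> 0 <= beta_ n <= beta)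
    (x : nat -> 'rV[R]_m)
    (x_gen : generated_by_algorithm f g F alpha_ beta_ x) :
  (\sum_(0 <= n <oo) (enorm (x n.+1 - x n))%:E < +oo)%E /\
  exists2 z, crit (fun y => (f y + (g y)%:E)%E) z & x n @[n --> \oo] --> z.
Proof.
move: h_M; cbv zeta.
set M1 := _ - mu * beta / _; set M2 := beta / (2 * mu * alpha_lo) => h_M.
pose h y := (f y + (g y)%:E)%E.
have M2_ge0 : 0 <= M2 by rewrite divr_ge0// !mulr_ge0// ltW.
have alo_a k : alpha_lo <= alpha_ k.+1 by have /andP[] := alpha_bounds k.+1 isT.
have a0 k : 0 < alpha_ k.+1 by exact: lt_le_trans (alo_a k).
have x_min k : argmin (inertial_objective f g F (alpha_ k.+1) (beta_ k.+1)
    (x k) (x k.+1)) (x k.+2) := x_gen k.+1 isT.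
have f_fin k : f (x k.+2) \is a fin_num :=
  argmin_fin_num f_proper (a0 k) (x_min k).
have h_fin k : h (x k.+2) \is a fin_num by rewrite fin_numD f_fin.
have hE k : fine (h (x k.+2)) = fine (f (x k.+2)) + g (x k.+2).
  by rewrite /h fineD.
have h_nyN y : h y != -oo%E.
  by have := f_proper.1 y; rewrite /h; case: (f y).
(* The lower bound on the step sizes lets one constant serve all iterations. *)
pose K := LF / (2 * alpha_lo) + Lg / 2.
have K_gt0 : 0 < K by rewrite ltr_wpDr ?divr_ge0// divr_gt0// mulr_gt0.
have v_subgrad k : proximal_subgradient K h (x k.+2)
    (step_subgradient g F (alpha_ k.+1) (beta_ k.+1) (x k) (x k.+1) (x k.+2)).
  apply: (step_proximal f_proper g_diff g_lip F_diff F_lip (a0 k) (x_min k)).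
  rewrite lerD2r ler_wpM2l ?(ltW LF_gt0)// lef_pV2 ?posrE ?mulr_gt0//.
  by rewrite ler_wpM2l.
have h_decrease k : fine (h (x k.+3))
      + (M2 + (M1 - M2)) * enorm (x k.+3 - x k.+2) ^+ 2 <=
    fine (h (x k.+2)) + M2 * enorm (x k.+2 - x k.+1) ^+ 2.
  have -> : M2 + (M1 - M2) = M1 by rewrite addrC subrK.
  rewrite !hE.
  exact: (step_decrease f_proper g_diff g_lip F_diff F_lip (a0 k.+1)
    (x_min k.+1) sigma_gt0 LF_gt0 F_sconvex (f_fin k) alpha_lo_gt0 mu_gt0
    (alpha_bounds k.+2 isT) (beta_bounds k.+2 isT)).
have h_le k : fine (h (x k.+2)) <=
    fine (h (x 2%N)) + M2 * enorm (x 2%N - x 1%N) ^+ 2.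
  suff : fine (h (x k.+2)) + M2 * enorm (x k.+2 - x k.+1) ^+ 2 <=
      fine (h (x 2%N)) + M2 * enorm (x 2%N - x 1%N) ^+ 2.
    by apply: le_trans; rewrite lerDl mulr_ge0 ?sqr_ge0.
  elim: k => [//|k ih]; apply: le_trans (le_trans (h_decrease k) ih).
  rewrite lerD2l ler_wpM2r ?sqr_ge0// lerDl subr_ge0; exact: ltW.
have [r hr] := fg_coercive (fine (h (x 2%N)) + M2 * enorm (x 2%N - x 1%N) ^+ 2).
have x_r k : enorm (x k.+2) <= r.
  rewrite leNgt; apply/negP => /hr; rewrite -/(h _) -(fineK (h_fin k)) lte_fin.
  by rewrite ltNge h_le.
(* Decrease and coercivity confine the iterates from [x 2] on; the two starting points are added by
   hand. *)
pose B := Num.max r (Num.max (enorm (x 0%N)) (enorm (x 1%N))).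
have x_B n : enorm (x n) <= B.
  rewrite !le_max; case: n => [|[|n]]; rewrite ?lexx ?orbT// x_r //.
have B_ge0 : 0 <= B := le_trans (enorm_ge0 _) (x_B 0%N).
have [c f_c] := f_bounded_below.
pose G := enorm (grad g 0).
(* [g] may be unbounded below, but on the ball of radius [B] its quadratic minorant at 0 bounds
   it. *)
have h_lbound k : c + (g 0 - G * B - Lg / 2 * B ^+ 2) <= fine (h (x k.+2)).
  rewrite hE lerD//.
    by rewrite -lee_fin fineK.
  have := descent_lemma_ge 0 (x k.+2) g_diff g_lip; rewrite subr0.
  apply: le_trans; rewrite -!addrA lerD2l lerD//.
    rewrite lerNl -dotpNr; apply: (le_trans (dotp_le _ _)).
    by rewrite enormN ler_wpM2l ?enorm_ge0.
  rewrite lerN2 ler_wpM2l ?divr_ge0// ler_pXn2r ?nnegrE ?enorm_ge0//.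
pose C1 := Lg + LF / alpha_lo + beta / alpha_lo.
have LFa : 0 <= LF / alpha_lo by rewrite divr_ge0// ltW.
have ba : 0 <= beta / alpha_lo by rewrite divr_ge0// ltW.
have v_le k : enorm (step_subgradient g F (alpha_ k.+1) (beta_ k.+1)
      (x k) (x k.+1) (x k.+2)) <=
    C1 * (enorm (x k.+2 - x k.+1) + enorm (x k.+1 - x k)).
  have /andP[b0 b_le] := beta_bounds k.+1 isT.
  apply: (le_trans (step_subgradient_le g_lip F_lip _ _ _ (a0 k) b0)).
  have ai : (alpha_ k.+1)^-1 <= alpha_lo^-1 by rewrite lef_pV2 ?posrE.
  rewrite mulrDr; apply: lerD; rewrite ler_wpM2r ?enorm_ge0//.
    apply: (@le_trans _ _ (Lg + LF / alpha_lo)); last by rewrite lerDl.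
    by rewrite lerD2l ler_wpM2l// ltW.
  apply: (@le_trans _ _ (beta / alpha_lo)); last by rewrite lerDr addr_ge0.
  by rewrite ler_pM ?invr_ge0 ?(ltW (a0 k)).
apply: (@kl_convergence R m h x _ K M2 (M1 - M2) C1 B _ _ h_nyN fg_semialg
  K_gt0 M2_ge0 _ _ h_fin v_subgrad v_le h_decrease x_B h_lbound).
- apply: lower_semicontinuousD_real => // y.
  exact: differentiable_continuous.
- by rewrite subr_gt0.
- by rewrite !addr_ge0.
Qed.
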